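(* Let $w\in S_n$ be a Grassmannian permutation. Then (1) $\mathfrak{G}_w$ has saturated Newton polytope and $\mathrm{Newton}(\mathfrak{G}_w)$ is a generalized polymatroid; and (2) if $\alpha\in\mathrm{supp}(\mathfrak{G}_w)$ and $|\alpha|<\deg\mathfrak{G}_w$, then there exists $\beta\in\mathrm{supp}(\mathfrak{G}_w)$ with $\alpha<\beta$ componentwise and $|\beta|=|\alpha|+1$.
   Context: A permutation is Grassmannian if it has exactly one descent (an index $i$ with $w(i)>w(i+1)$). Permutations act on the right; $s_j$ swaps positions $j,j+1$. With $\partial_j f=\frac{f-s_jf}{x_j-x_{j+1}}$ ($s_jf$ swaps $x_j,x_{j+1}$) and $\overline{\partial}_j f=\partial_j((1-x_{j+1})f)$, the Grothendieck polynomial is defined by $\mathfrak{G}_{w_0}=x_1^{n-1}\cdots x_{n-1}$ for $w_0=n(n-1)\cdots1$ and $\mathfrak{G}_w=\overline{\partial}_j\mathfrak{G}_{ws_j}$ when $w(j)<w(j+1)$. $\mathrm{supp}(f)$ is the set of exponent vectors with nonzero coefficient, $\mathrm{Newton}(f)$ its convex hull; $f$ has saturated Newton polytope (SNP) if $\mathrm{Newton}(f)\cap\mathbb{Z}^n=\mathrm{supp}(f)$. $|\alpha|=\sum_i\alpha_i$; $\alpha<\beta$ means $\alpha_i\le\beta_i$ for all $i$ and $\alpha\neq\beta$. A function $z:2^{[n]}\to\mathbb{R}$ is submodular if $z(I)+z(J)\ge z(I\cup J)+z(I\cap J)$ for all $I,J$, and $y$ is supermodular if $-y$ is submodular. A pair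 $(y,z)$ is paramodular if $y$ is supermodular, $z$ submodular, and $z(I)-y(J)\ge z(I\setminus J)-y(J\setminus I)$ for all $I,J\subseteq[n]$. A generalized polymatroid is a polytope of the form $\{t\in\mathbb{R}^n: y(I)\le\sum_{i\in I}t_i\le z(I)\ \forall I\subseteq[n]\}$ for a paramodular pair $(y,z)$. *)

(* Defs.v *)
From HB Require Import structures.
From mathcomp Require Import all_boot all_order all_algebra all_fingroup.
From mathcomp Require Import reals.
From mathcomp Require Import mpoly.
From Stdlib Require Import ClassicalEpsilon.

Set Implicit Arguments.
Unset Strict Implicit.
Unset Printing Implicit Defensive.

Import Order.TTheory GRing.Theory Num.Theory.
Local Open Scope ring_scope.

Section Grothendieck.
Variable n : nat.

(* Positions/variables are 0-based: position i of the paper is (i-1 : 'I_n). *)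

(* successor index j+1 (only meaningful when j.+1 < n) *)
Definition succ_ord (j : 'I_n) : 'I_n := insubd j j.+1.

Definition sadj (j : 'I_n) : 'S_n := tperm j (succ_ord j).

(* right action: (w s_j)(i) = w (s_j i), i.e. swap positions j, j+1 of w *)
Definition rmul (w : 'S_n) (j : 'I_n) : 'S_n := (sadj j * w)%g.

Definition ascent (w : 'S_n) (j : 'I_n) : bool :=
  (j.+1 < n)%N && (w j < w (succ_ord j))%N.

Definition descent (w : 'S_n) (j : 'I_n) : bool :=
  (j.+1 < n)%N && (w (succ_ord j) < w j)%N.

Definition grassmannian (w : 'S_n) : bool :=
  #|[set j | descent w j]| == 1%N.

(* divided difference: d_j f is the (unique) g with
   (x_j - x_{j+1}) g = f - s_j f *)
Definition divdiff (j : 'I_n) (f : {mpoly int[n]}) : {mpoly int[n]} :=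
  epsilon (inhabits 0)
    (fun g => ('X_j - 'X_(succ_ord j)) * g = f - msym (sadj j) f).

Definition dbar (j : 'I_n) (f : {mpoly int[n]}) : {mpoly int[n]} :=
  divdiff j ((1 - 'X_(succ_ord j)) * f).

Definition groth_top : {mpoly int[n]} :=
  \prod_(i < n) 'X_i ^+ (n - 1 - i).

(* number of non-inversions of w = distance from w to w0 in weak order *)
Definition ninv (w : 'S_n) : nat :=
  #|[set p : 'I_n * 'I_n | (p.1 < p.2)%N && (w p.1 < w p.2)%N]|.

(* G_w = dbar_j G_{w s_j} for an ascent j of w; the choice of j is
   irrelevant (well-definedness of the paper's definition), we pick one. *)
Fixpoint groth_fuel (k : nat) (w : 'S_n) : {mpoly int[n]} :=
  match k with
  | 0%N => groth_top
  | k'.+1 =>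
    match [pick j | ascent w j] with
    | None => groth_top
    | Some j => dbar j (groth_fuel k' (rmul w j))
    end
  end.

Definition groth (w : 'S_n) : {mpoly int[n]} := groth_fuel (ninv w) w.

Definition tdeg (f : {mpoly int[n]}) : nat :=
  \max_(m <- msupp f) mdeg m.

Variable R : realType.

Definition in_hull (S : seq 'X_{1..n}) (t : 'I_n -> R) : Prop :=
  exists lam : 'X_{1..n} -> R,
    [/\ forall m, m \in S -> 0 <= lam m,
        \sum_(m <- S) lam m = 1 &
        forall i, t i = \sum_(m <- S) lam m * (m i)%:R].

Definition SNP (f : {mpoly int[n]}) : Prop :=
  forall a : 'I_n -> int,
    in_hull (msupp f) (fun i => (a i)%:~R) <->
    exists2 m, m \in msupp f & forall i, a i = (m i)%:Z.

Definition supermodular (y : {set 'I_n} -> R) : Prop :=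
  forall I J, y I + y J <= y (I :|: J) + y (I :&: J).

Definition submodular (z : {set 'I_n} -> R) : Prop :=
  forall I J, z I + z J >= z (I :|: J) + z (I :&: J).

Definition paramodular (y z : {set 'I_n} -> R) : Prop :=
  [/\ supermodular y, submodular z &
      forall I J, z I - y J >= z (I :\: J) - y (J :\: I)].

Definition newton_gen_polymatroid (f : {mpoly int[n]}) : Prop :=
  exists y z : {set 'I_n} -> R,
    paramodular y z /\
    forall t : 'I_n -> R,
      in_hull (msupp f) t <->
      (forall I : {set 'I_n}, y I <= \sum_(i in I) t i <= z I).

End Grothendieck.

Definition mlt (n : nat) (a b : 'X_{1..n}) : Prop :=
  (forall i, (a i <= b i)%N) /\ a <> b.

(* Main.v *)
Require Import Defs.
From HB Require Import structures.
From mathcomp Require Import all_boot all_order all_algebra all_fingroup.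
From mathcomp Require Import reals zify ring lra.
From mathcomp Require Import mpoly.

(* Let k be the descent of w. Since the operators dbar_j satisfy the commutation and
   braid relations, groth w may be computed along any chain of ascents. Going up from w
   to the permutation whose first k values are decreasing, one ends at a dominant
   permutation, whose Grothendieck polynomial is a monomial; pairing with the alternating
   sum over S_k turns this chain into Lenart's bialternant formula
     groth w * det (x_j^(k-i) (1-x_j)^(i-1)) = det (x_j^(la_i+k-i) (1-x_j)^(i-1)).
   A column reduction of the determinant gives the branching rule of set-valued tableaux
   in the last variable x_k. All terms of the rule have the same sign in each degree, so
   supports add up as Minkowski sums, and an induction on k shows that the support
   consists of the m in N^k such that, for every set I of variables,
     (sum of the #|I| smallest rows of la) <= m(I) <= (sum of the #|I| largest rows of hat la)
   where hat la_r = min_(s <= r) (la_s + s), rows being numbered from 0.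
   These bounds form a paramodular pair; generalized polymatroids with integral bounds
   are integral, which gives part (1), and part (2) follows since the sets attaining the
   upper bound are closed under union. *)

Set Implicit Arguments.
Unset Strict Implicit.
Unset Printing Implicit Defensive.

(** * Partitions *)

Lemma descending_leq (K : nat) (f : nat -> nat) :
  (forall i, (i.+1 < K)%N -> (f i.+1 <= f i)%N) ->
  forall i l, (i <= l)%N -> (l < K)%N -> (f l <= f i)%N.
Proof.
move=> h i l; elim: l => [|l IH]; first by rewrite leqn0 => /eqP ->.
rewrite leq_eqVlt => /predU1P[-> //|il] lK.
by apply: leq_trans (h _ lK) (IH _ _); lia.
Qed.

Section Partitions.
Implicit Types (la mu nu : nat -> nat).

(* Row lengths of the largest shape reachable from [la] when row r may gain r cells. *)
Fixpoint hat la (r : nat) : nat :=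
  if r is r'.+1 then minn (hat la r') (la r + r) else la 0.

Lemma hat_leq la r : hat la r <= la r + r.
Proof. by case: r => [|r] /=; rewrite ?addn0 // geq_minr. Qed.

Lemma hat_max la r x : (forall s, s <= r -> x <= la s + s) -> x <= hat la r.
Proof.
elim: r => [|r IH] h /=; first by have := h 0 isT; rewrite addn0.
by rewrite leq_min h // IH // => s sr; apply: h; lia.
Qed.

Lemma leq_hat la mu r : (forall s, s <= r -> mu s <= la s) -> hat mu r <= hat la r.
Proof.
move=> h; elim: r h => [|r IH] h /=; first exact: h.
by rewrite leq_min !geq_min IH ?leq_add2r ?h ?orbT // => s sr; apply: h; lia.
Qed.

Lemma hat_dec la r : hat la r.+1 <= hat la r.
Proof. exact: geq_minl. Qed.

Lemma eq_hat la mu r : (forall s, s <= r -> mu s = la s) -> hat mu r = hat la r.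
Proof.
by move=> h; apply/eqP; rewrite eqn_leq !leq_hat // => s sr; rewrite h.
Qed.

Lemma hat_geq la k : (forall i, i.+1 < k -> la i.+1 <= la i) ->
  forall r, r < k -> la r <= hat la r.
Proof.
move=> dec r rk; apply: hat_max => s; elim: r rk => [|r IH] rk; first by rewrite leqn0 => /eqP ->; lia.
rewrite leq_eqVlt => /predU1P[->|]; first by lia.
by rewrite ltnS => /(IH (ltnW rk)); have := dec r rk; lia.
Qed.

Definition interlace k la mu := forall i, i < k -> la i.+1 <= mu i <= la i.

Definition psum (f : nat -> nat) (j : nat) : nat := \sum_(r < j) f r.

Lemma psum0 f : psum f 0 = 0.
Proof. exact: big_ord0. Qed.

Lemma psumS f j : psum f j.+1 = psum f j + f j.
Proof. exact: big_ord_recr. Qed.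

Lemma leq_psum f g j : (forall i, i < j -> f i <= g i) -> psum f j <= psum g j.
Proof. by move=> h; apply: leq_sum => i _; apply: h. Qed.

Lemma eq_psum f g j : (forall i, i < j -> f i = g i) -> psum f j = psum g j.
Proof. by move=> h; apply: eq_bigr => i _; apply: h. Qed.

(** Equal to 1 when the last cell of row r of [mu] has no cell of [la] below it: in a set-valued
    tableau such a cell may also contain the new largest entry. *)
Definition corners la mu (r : nat) : nat := la r.+1 < mu r.

(** Sums [la i.+1 <= mu i] over [j <= i < k]; this becomes the lower bound for sets of variables
    avoiding the last one. *)
Lemma sum_interlace_low k la mu j : interlace k la mu -> j <= k ->
  psum la k.+1 + psum mu j <= psum mu k + psum la j.+1.
Proof.
elim: k => [|k IH] h; first by rewrite leqn0 => /eqP ->; rewrite addnC.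
rewrite leq_eqVlt => /predU1P[->|]; first by rewrite addnC.
rewrite ltnS => jk; have := IH (fun i ik => h i (ltnW ik)) jk; have := h k (ltnSn k).
by rewrite (psumS la k.+1) (psumS mu k); lia.
Qed.

(** The last variable has exponent at most [psum la k.+1 - psum mu k + psum (corners la mu) k], so
    this becomes the upper bound for sets containing it. Each row satisfies
    [la i.+1 + corners la mu i <= mu i]; when j is maximal, both terms of the minimum defining the
    last row of [hat la] are checked. *)
Lemma sum_interlace_high k la mu j : interlace k la mu -> j <= k ->
  psum la k.+1 + psum (corners la mu) k + psum (hat mu) j <= psum (hat la) j.+1 + psum mu k.
Proof.
elim: k j => [|k IH] j h.
  by rewrite leqn0 => /eqP ->; rewrite !psumS !psum0 /= !addn0.
have h' : interlace k la mu by move=> i ik; apply: h; lia.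
have hk := h k (ltnSn k); rewrite leq_eqVlt => /predU1P[->|]; last first.
  rewrite ltnS => /(IH _ h'); rewrite (psumS la k.+1) (psumS mu k) (psumS (corners la mu) k) /corners.
  by case: (ltnP (la k.+1) (mu k)); lia.
have := IH k h' (leqnn k); have := hat_leq mu k; have : hat mu k <= hat la k.
  by apply: leq_hat => s sk; have := h s; lia.
rewrite (psumS la k.+1) (psumS mu k) (psumS (hat mu) k) (psumS (hat la) k.+1) (psumS (corners la mu) k) /=.
by rewrite /corners; case: (ltnP (la k.+1) (mu k)); move: hk; lia.
Qed.

Lemma psum_diff (f : nat -> nat) k : (forall j, j < k -> f j <= f j.+1) ->
  forall j, j <= k -> psum (fun r => f r.+1 - f r) j = f j - f 0.
Proof.
move=> h; suff E j : j <= k -> f 0 <= f j /\ psum (fun r => f r.+1 - f r) j = f j - f 0.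
  by move=> j /E [].
elim: j => [|j IH] jk; first by rewrite psum0 subnn.
by rewrite psumS; have [] := IH (ltnW jk); have := h j jk; lia.
Qed.

(** Induction on [T - psum lo k], raising [lo] by one at the first [a] with [lo a < hi a]. The
    result stays decreasing, since the row i just before [a] has [lo i = hi i >= hi a > lo a]. *)
Lemma interpolate k (lo hi : nat -> nat) T :
  (forall i, i < k -> lo i <= hi i) ->
  (forall i, i.+1 < k -> lo i.+1 <= lo i) -> (forall i, i.+1 < k -> hi i.+1 <= hi i) ->
  psum lo k <= T <= psum hi k ->
  exists mu, [/\ forall i, i < k -> lo i <= mu i <= hi i,
    forall i, i.+1 < k -> mu i.+1 <= mu i & psum mu k = T].
Proof.
move=> lohi dlo dhi /andP[loT Thi].
have [d] := ubnP (T - psum lo k); elim: d lo lohi dlo loT => // d IH lo lohi dlo loT dd.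
have [T0|T0] := leqP T (psum lo k).
  by exists lo; split=> // [i ik|]; [rewrite leqnn lohi | lia].
have [/existsP ex|/existsPn no] := boolP [exists i : 'I_k, lo i < hi i]; last first.
  have : psum hi k <= psum lo k.
    by apply: leq_sum => i _; have := no i; rewrite -leqNgt.
  by lia.
have ex' : exists i, (i < k) && (lo i < hi i) by case: ex => i h; exists i; rewrite ltn_ord.
case: (ex_minnP ex') => a /andP[ak la] amin.
pose lo' i := lo i + (i == a).
have S : psum lo' k = (psum lo k).+1.
  rewrite [LHS]big_split /= -addn1; congr addn.
  by rewrite (bigD1 (Ordinal ak)) //= eqxx big1 // => i; rewrite -val_eqE /= => /negPf ->.
have [||||mu [h1 h2 h3]] := IH lo'.
- by move=> i ik; rewrite /lo'; have := lohi i ik; case: eqP => [->|]; lia.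
- move=> i ik; rewrite /lo'; case: (i.+1 =P a) => [E|_]; last by have := dlo i ik; lia.
  by have := amin i; have := dhi i ik; have := lohi i; rewrite E; lia.
- by rewrite S.
- by rewrite S; lia.
exists mu; split=> // i ik; have := h1 i ik; rewrite /lo'; lia.
Qed.

(** The shape [nu'] is built from its partial sums, which are the largest possible: [nu' i <= nu i]
    bounds them by [psum nu j], and [nu i.+1 <= nu' i] on the remaining rows bounds them by
    [psum nu j.+1 - a]. *)
Lemma remove_strip k nu a : (forall i, i.+1 < k.+1 -> nu i.+1 <= nu i) ->
  nu k <= a <= nu 0 ->
  exists nu', [/\ interlace k nu nu', psum nu' k + a = psum nu k.+1 &
    forall j, j <= k -> psum nu' j = minn (psum nu j) (psum nu j.+1 - a)].
Proof.
move=> dec /andP[ka a0]; pose f j := minn (psum nu j) (psum nu j.+1 - a).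
have aj j : a <= psum nu j.+1.
  by elim: j => [|j IH]; rewrite psumS ?psum0 //; apply: leq_trans IH (leq_addr _ _).
have fS j : j < k -> f j + nu j.+1 <= f j.+1 <= f j + nu j.
  move=> jk; have := dec j jk; have := aj j; have := aj j.+1.
  by rewrite /f !psumS; lia.
have fj j : j <= k -> psum (fun r => f r.+1 - f r) j = f j.
  move=> jk; rewrite (@psum_diff f k) //; last by move=> i /fS; lia.
  by rewrite {2}/f psum0 min0n subn0.
exists (fun r => f r.+1 - f r); split => // [i ik|].
  by have := fS i ik; lia.
by rewrite fj // /f; have := aj k; rewrite psumS; lia.
Qed.

(** Any [mu] between [lo] and [hi] interlaces with [la] and satisfies [mu <= nu' <= hat mu]; only
    the size of [mu] remains to be adjusted. *)
Lemma strip_choice k la nu nu' a :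
  (forall i, i.+1 < k.+1 -> la i.+1 <= la i) ->
  (forall i, i < k.+1 -> la i <= nu i <= hat la i) ->
  interlace k nu nu' -> psum nu' k + a = psum nu k.+1 ->
  exists mu, [/\ interlace k la mu, forall i, i.+1 < k -> mu i.+1 <= mu i,
    forall i, i < k -> mu i <= nu' i <= hat mu i &
    psum la k.+1 <= a + psum mu k <= psum la k.+1 + psum (corners la mu) k].
Proof.
move=> dla lanu nunu' suma.
have dnu' i : i.+1 < k -> nu' i.+1 <= nu' i.
  by move=> ik; have := nunu' i (ltnW ik); have := nunu' i.+1 ik; lia.
pose lo i := maxn (la i.+1) (nu' i - i); pose hi i := minn (la i) (nu' i).
have lohi i : i < k -> lo i <= hi i.
  move=> ik; have := nunu' i ik; have := lanu i (ltnW ik); have := lanu i.+1 ik.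
  by have := hat_leq la i; have := dla i ik; rewrite /lo /hi; lia.
have dlo i : i.+1 < k -> lo i.+1 <= lo i.
  by move=> ik; have := dnu' i ik; have := dla i.+1 ik; rewrite /lo; lia.
have dhi i : i.+1 < k -> hi i.+1 <= hi i.
  by move=> ik; have := dnu' i ik; have := dla i (ltnW ik); rewrite /hi; lia.
have good mu : (forall i, i < k -> lo i <= mu i <= hi i) ->
    interlace k la mu /\ forall i, i < k -> mu i <= nu' i <= hat mu i.
  move=> h; split=> i ik; first by have := h i ik; rewrite /lo /hi; lia.
  apply/andP; split; first by have := h i ik; rewrite /hi; lia.
  apply: hat_max => s si; have sk := leq_ltn_trans si ik.
  have := descending_leq dnu' si ik.
  by have := h s sk; rewrite /lo; lia.
have hi_sum : psum la k.+1 <= a + psum hi k.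
  have : psum la k.+1 + psum nu' k <= psum nu k.+1 + psum hi k.
    have hk := lanu k (ltnSn k); rewrite !psumS.
    suff : psum la k + psum nu' k <= psum nu k + psum hi k by lia.
    rewrite -!big_split /=; apply: leq_sum => i _; have := ltn_ord i => ik.
    by have := lanu i (ltnW ik); have := nunu' i ik; rewrite /hi; lia.
  by lia.
(* Row by row: either [lo r = la r.+1], and [nu r.+1 <= nu' r]; or [lo r = nu' r - r] exceeds
   [la r.+1], and [nu r.+1 <= la r.+1 + r.+1] while the corner adds 1. The induction starts from
   [hat la 0 = la 0]. *)
have lo_sum : a + psum lo k <= psum la k.+1 + psum (corners la lo) k.
  have : psum nu k.+1 + psum lo k <= psum la k.+1 + psum nu' k + psum (corners la lo) k.
    have h0 := lanu 0 isT; rewrite /= in h0.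
    elim: {-2}k (leqnn k) => [|r IH] rk; first by rewrite !psumS !psum0; lia.
    have := IH (ltnW rk); rewrite (psumS nu r.+1) (psumS la r.+1) !(psumS _ r).
    have := nunu' r rk; have := lanu r.+1 rk; have := hat_leq la r.+1.
    by rewrite {3}/corners {2 4}/lo; case: ltnP; rewrite /lo; lia.
  by lia.
(* If [lo] is large enough, its corners absorb the excess of [a] over the size of the strip;
   otherwise [mu] is enlarged until the strip has size exactly [a]. *)
have [big|small] := leqP (psum la k.+1) (a + psum lo k).
  have [|h1 h2] := good lo; first by move=> i ik; rewrite leqnn lohi.
  by exists lo; split=> //; apply/andP.
have [|mu [h1 h2 h3]] := @interpolate k lo hi (psum la k.+1 - a) lohi dlo dhi; first by lia.
have [m1 m2] := good mu h1.
by exists mu; split=> //; lia.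
Qed.

(** The [e] extra cells fill the rows of [hat la] from the top, which makes all partial sums as
    large as possible. *)
Lemma dominating_shape k la e :
  (forall i, i.+1 < k -> la i.+1 <= la i) -> psum la k + e <= psum (hat la) k ->
  exists nu, [/\ forall i, i.+1 < k -> nu i.+1 <= nu i,
    forall i, i < k -> la i <= nu i <= hat la i &
    forall j, j <= k -> psum nu j = minn (psum (hat la) j) (psum la j + e)].
Proof.
move=> dec le; pose f j := minn (psum (hat la) j) (psum la j + e).
have lahat := hat_geq dec.
have fS j : j < k -> f j + la j <= f j.+1 <= f j + hat la j.
  by move=> jk; have := lahat j jk; rewrite /f !psumS; lia.
exists (fun r => f r.+1 - f r); split=> [i ik|i ik|j jk].
- have := dec i ik; have := hat_dec la i; have := lahat i (ltnW ik); have := lahat _ ik.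
  by rewrite /f !psumS; lia.
- by have := fS i ik; lia.
- rewrite (@psum_diff f k) //; last by move=> i /fS; lia.
  by rewrite {2}/f psum0 min0n subn0.
Qed.

End Partitions.

Import Order.TTheory GRing.Theory Num.Theory.
Local Open Scope ring_scope.

(** * The operators dbar *)

Section LinearCombination.
Variable K : pzRingType.
Implicit Types A B C D L k : K.

(** With [eq_add] and [eq_scale], this reduces an identity to an explicit linear combination of
    known equations, leaving a goal for [ring]. *)
Lemma eq_lin L R A B : A = B -> L - R = A - B -> L = R.
Proof. by move=> -> /eqP; rewrite subrr subr_eq0 => /eqP. Qed.

Lemma eq_add A B C D : A = B -> C = D -> A + C = B + D.
Proof. by move=> -> ->. Qed.

Lemma eq_scale k A B : A = B -> k * A = k * B.
Proof. by move=> ->. Qed.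

End LinearCombination.

Section DividedDifferences.
Variable n : nat.
Implicit Types (f g : {mpoly int[n]}) (i j : 'I_n).

Lemma msym_X (s : 'S_n) i : msym s 'X_i = 'X_(s i) :> {mpoly int[n]}.
Proof.
rewrite msymX; congr mpolyX; apply/mnmP => j.
by rewrite mnmE !mnm1E -(inj_eq (@perm_inj _ s)) permKV.
Qed.

Lemma mpolyX_sub_neq0 i j : i != j -> 'X_i - 'X_j != 0 :> {mpoly int[n]}.
Proof.
move=> nij; apply/eqP => /(congr1 (mcoeff U_(i))).
by rewrite mcoeffB !mcoeffXU mcoeff0 eqxx eq_sym (negPf nij).
Qed.

(** By the twisted product rule [p q - s(p q) = (p - s p) q + s p (q - s q)], divisibility only has
    to be checked on variables. *)
Lemma sub_msym_tperm_dvd i j f :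
  exists g, ('X_i - 'X_j) * g = f - msym (tperm i j) f.
Proof.
pose Q f := exists g, ('X_i - 'X_j) * g = f - msym (tperm i j) f.
have QM p q : Q p -> Q q -> Q (p * q).
  case=> g Eg [h Eh]; exists (g * q + msym (tperm i j) p * h).
  rewrite msymM; apply: (eq_lin (eq_add (eq_scale q Eg) (eq_scale (msym (tperm i j) p) Eh))).
  by ring.
have Q1 : Q 1 by exists 0; rewrite msym1 subrr mulr0.
have QX k : Q 'X_k.
  rewrite /Q msym_X; case: tpermP => [->|->|_ _].
  - by exists 1; rewrite mulr1.
  - by exists (-1); ring.
  - by exists 0; rewrite subrr mulr0.
elim/mpolyind: f => [|c m p _ _ [g Eg]].
  by exists 0; rewrite msym0 subrr mulr0.
have [h Eh] : Q 'X_[m].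
  rewrite mpolyXE_id; elim/big_ind: _ => // k _.
  by elim: (m k) => [|e IH]; rewrite ?expr0 // exprS; apply: QM.
by exists (c *: h + g); rewrite mulrDr -scalerAr Eh Eg msymD msymZ scalerBr; ring.
Qed.

(** The existence of the quotient turns the [epsilon] in [divdiff] into an equation. Later
    identities between operators are proved from it after multiplying by differences of
    variables. *)
Lemma dbarE j f :
  ('X_j - 'X_(succ_ord j)) * dbar j f =
  (1 - 'X_(succ_ord j)) * f - (1 - 'X_j) * msym (sadj j) f.
Proof.
have := sub_msym_tperm_dvd j (succ_ord j) ((1 - 'X_(succ_ord j)) * f).
move=> /(ClassicalEpsilon.epsilon_spec (inhabits 0)); rewrite -/(divdiff j _) -/(dbar j f) => ->.
by rewrite msymM msymB msym1 msym_X tpermR.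
Qed.

Lemma val_succ_ord j : (j.+1 < n)%N -> succ_ord j = j.+1 :> nat.
Proof. by move=> h; rewrite /succ_ord insubdK. Qed.

Lemma succ_ord_neq j : (j.+1 < n)%N -> j != succ_ord j.
Proof. by move=> h; rewrite -val_eqE /= val_succ_ord //; lia. Qed.

Lemma X_sub_succ_neq0 j : (j.+1 < n)%N -> 'X_j - 'X_(succ_ord j) != 0 :> {mpoly int[n]}.
Proof. by move=> h; apply/mpolyX_sub_neq0/succ_ord_neq. Qed.

Lemma msym_dbar j f : msym (sadj j) (dbar j f) = dbar j f.
Proof.
(* For the last index, the default value in [succ_ord] gives [succ_ord j = j], and [sadj j] is the
   identity. *)
have [E|] := eqVneq j (succ_ord j); first by rewrite /sadj -E tperm1 msym1m.
move=> /mpolyX_sub_neq0 h; apply: (mulfI h).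
rewrite dbarE; have /(congr1 (msym (sadj j))) := dbarE j f.
rewrite !(msymM, msymB, msym1) !msym_X tpermL tpermR -msymMm tperm2 msym1m => E.
by apply: (eq_lin (eq_scale (-1) E)); ring.
Qed.

Lemma sadj_commute i j : (i.+1 < j)%N -> (j.+1 < n)%N ->
  (sadj i * sadj j = sadj j * sadj i)%g.
Proof.
move=> ij jn; rewrite [LHS]conjgC {1}/sadj tpermJ.
by rewrite /sadj !tpermD // -val_eqE /= ?val_succ_ord //; lia.
Qed.

Lemma sadj_braid i j : j = i.+1 :> nat -> (j.+1 < n)%N ->
  (sadj i * sadj j * sadj i = sadj j * sadj i * sadj j)%g.
Proof.
move=> ij jn; have Ej : succ_ord i = j by apply/val_inj; rewrite /= val_succ_ord //; lia.
have ni : i != j by rewrite -val_eqE /= ij; lia.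
have nk : i != succ_ord j by rewrite -val_eqE /= val_succ_ord //; lia.
have nj := succ_ord_neq jn.
have E : (sadj j ^ sadj i = sadj i ^ sadj j)%g.
  by rewrite {1}/sadj tpermJ [X in _ = (X ^ _)%g]/sadj tpermJ /sadj Ej tpermR !tpermL !tpermD // eq_sym.
have [sV tV] : ((sadj i)^-1 = sadj i /\ (sadj j)^-1 = sadj j)%g by rewrite /sadj !tpermV.
by move: E; rewrite !conjgE sV tV !mulgA => ->.
Qed.

(** Here x, y, z, u stand for 1 minus the variables i, i+1, j, j+1, and e, s, t, st for f and its
    images under [s_i], [s_j] and both. Both sides equal [y u e - x u s - y z t + x z st]. *)
Lemma commute_identity (K : comPzRingType) (x y z u e s t st a sa b tb c d : K) :
  (u - z) * a = u * e - z * t -> (u - z) * sa = u * s - z * st ->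
  (y - x) * b = y * e - x * s -> (y - x) * tb = y * t - x * st ->
  (y - x) * c = y * a - x * sa -> (u - z) * d = u * b - z * tb ->
  (u - z) * ((y - x) * c) = (u - z) * ((y - x) * d).
Proof.
move=> Ea Esa Eb Etb Ec Ed.
apply: (eq_lin (eq_add (eq_scale (u - z) Ec) (eq_add (eq_scale (x - y) Ed)
  (eq_add (eq_scale y Ea) (eq_add (eq_scale (- x) Esa)
  (eq_add (eq_scale (- u) Eb) (eq_scale z Etb))))))).
by ring.
Qed.

Lemma dbar_commute i j f : (i.+1 < j)%N -> (j.+1 < n)%N ->
  dbar i (dbar j f) = dbar j (dbar i f).
Proof.
move=> ij jn; have jn' := val_succ_ord jn.
have in' : (i.+1 < n)%N by lia.
have in'' := val_succ_ord in'.
have [iX isX] : sadj j i = i /\ sadj j (succ_ord i) = succ_ord i.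
  by rewrite /sadj !tpermD // -val_eqE /= ?in'' ?jn'; lia.
have [jX jsX] : sadj i j = j /\ sadj i (succ_ord j) = succ_ord j.
  by rewrite /sadj !tpermD // -val_eqE /= ?in'' ?jn'; lia.
have C := sadj_commute ij jn.
have := congr1 (msym (sadj j)) (dbarE i f).
have := congr1 (msym (sadj i)) (dbarE j f).
rewrite !(msymM, msymB, msym1) !msym_X iX isX jX jsX -!msymMm C => Ei Ej.
have XB a b : 'X_a - 'X_b = (1 - 'X_b) - (1 - 'X_a) :> {mpoly int[n]} by ring.
apply: (mulfI (X_sub_succ_neq0 in')); apply: (mulfI (X_sub_succ_neq0 jn)).
rewrite !XB; rewrite !XB in Ei Ej.
have Di g := dbarE i g; have Dj g := dbarE j g; rewrite !XB in Di Dj.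
exact: (@commute_identity _ (1 - 'X_i) (1 - 'X_(succ_ord i)) (1 - 'X_j) (1 - 'X_(succ_ord j))
  _ _ _ _ _ _ _ _ _ _ (Dj f) Ei (Di f) Ej (Di (dbar j f)) (Dj (dbar i f))).
Qed.

(* Both sides of the braid relation are the same alternating sum over S_3; here
   x, y, z stand for 1 - x_i, 1 - x_(i+1), 1 - x_(i+2). *)
Lemma braid_identityl (K : comPzRingType) (x y z e s t st ts sts a sa ta sta b sb c : K) :
  (y - x) * a = y * e - x * s ->
  (x - y) * sa = x * s - y * e ->
  (z - x) * ta = z * t - x * ts ->
  (z - y) * sta = z * st - y * sts ->
  (z - y) * b = z * a - y * ta ->
  (z - x) * sb = z * sa - x * sta ->
  (y - x) * c = y * b - x * sb ->
  (y - x) * ((y - x) * (z - x) * (z - y) * c) = (y - x) *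
  (z ^+ 2 * (y * e - x * s)
   - y ^+ 2 * (z * t - x * ts)
   + x ^+ 2 * (z * st - y * sts)).
Proof.
move=> Ea Esa Eta Esta Eb Esb Ec.
apply: (eq_lin (eq_add (eq_scale ((y - x) * (z - x) * (z - y)) Ec)
 (eq_add (eq_scale (y * (y - x) * (z - x)) Eb)
 (eq_add (eq_scale (- x * (y - x) * (z - y)) Esb)
 (eq_add (eq_scale (y * z * (z - x)) Ea)
 (eq_add (eq_scale (- y ^+ 2 * (y - x)) Eta)
 (eq_add (eq_scale (x * z * (z - y)) Esa)
 (eq_scale (x ^+ 2 * (y - x)) Esta)))))))).
by ring.
Qed.

Lemma braid_identityr (K : comPzRingType) (x y z e s t st ts tst a sa ta tsa b tb c : K) :
  (z - y) * a = z * e - y * t ->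
  (y - z) * ta = y * t - z * e ->
  (z - x) * sa = z * s - x * st ->
  (y - x) * tsa = y * ts - x * tst ->
  (y - x) * b = y * a - x * sa ->
  (z - x) * tb = z * ta - x * tsa ->
  (z - y) * c = z * b - y * tb ->
  (z - y) * ((y - x) * (z - x) * (z - y) * c) = (z - y) *
  (z ^+ 2 * (y * e - x * s)
   - y ^+ 2 * (z * t - x * ts)
   + x ^+ 2 * (z * st - y * tst)).
Proof.
move=> Ea Eta Esa Etsa Eb Etb Ec.
apply: (eq_lin (eq_add (eq_scale ((y - x) * (z - x) * (z - y)) Ec)
 (eq_add (eq_scale (z * (z - x) * (z - y)) Eb)
 (eq_add (eq_scale (- y * (y - x) * (z - y)) Etb)
 (eq_add (eq_scale (z * y * (z - x)) Ea)
 (eq_add (eq_scale (- z * x * (z - y)) Esa)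
 (eq_add (eq_scale (y * z * (y - x)) Eta)
 (eq_scale (y * x * (z - y)) Etsa)))))))).
by ring.
Qed.

Lemma dbar_braid i j f : j = i.+1 :> nat -> (j.+1 < n)%N ->
  dbar i (dbar j (dbar i f)) = dbar j (dbar i (dbar j f)).
Proof.
move=> ij jn; have jn' := val_succ_ord jn.
have Ej : succ_ord i = j by apply/val_inj; rewrite /= val_succ_ord //; lia.
set k := succ_ord j.
have [ni nj nk] : [/\ i != j, j != k & i != k].
  by rewrite -!val_eqE /= jn' ij; split; lia.
have si : sadj i = tperm i j by rewrite /sadj Ej.
have sj : sadj j = tperm j k by [].
have [s1 [s2 s3]] : sadj i i = j /\ sadj i j = i /\ sadj i k = k.
  by rewrite si tpermL tpermR tpermD.
have [t1 [t2 t3]] : sadj j i = i /\ sadj j j = k /\ sadj j k = j.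
  by rewrite sj tpermL tpermR tpermD // eq_sym.
have B := sadj_braid ij jn.
have nij := mpolyX_sub_neq0 ni; have njk := mpolyX_sub_neq0 nj; have nik := mpolyX_sub_neq0 nk.
have Di g := dbarE i g; have Dj g := dbarE j g; rewrite Ej -/k in Di Dj.
have XB a b : 'X_a - 'X_b = (1 - 'X_b) - (1 - 'X_a) :> {mpoly int[n]} by ring.
have sDi g := congr1 (msym (sadj i)) (Di g); have sDj g := congr1 (msym (sadj i)) (Dj g).
have tDi g := congr1 (msym (sadj j)) (Di g); have tDj g := congr1 (msym (sadj j)) (Dj g).
have stDi g := congr1 (msym (sadj i)) (tDi g); have tsDj g := congr1 (msym (sadj j)) (sDj g).
have ss g : msym (sadj i) (msym (sadj i) g) = g by rewrite -msymMm tperm2 msym1m.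
have tt g : msym (sadj j) (msym (sadj j) g) = g by rewrite -msymMm tperm2 msym1m.
have BB g : msym (sadj j) (msym (sadj i) (msym (sadj j) g)) =
            msym (sadj i) (msym (sadj j) (msym (sadj i) g)).
  by rewrite -!msymMm mulgA -B mulgA.
have E := (msymM, msymB, msym1, msym_X, s1, s2, s3, t1, t2, t3).
rewrite !XB in Di Dj sDi sDj tDi tDj stDi tsDj nij njk nik.
apply: (mulfI (mulf_neq0 (mulf_neq0 nij nik) njk)).
transitivity ((1 - 'X_k) ^+ 2 * ((1 - 'X_j) * f - (1 - 'X_i) * msym (sadj i) f)
   - (1 - 'X_j) ^+ 2 * ((1 - 'X_k) * msym (sadj j) f - (1 - 'X_i) * msym (sadj j) (msym (sadj i) f))
   + (1 - 'X_i) ^+ 2 * ((1 - 'X_k) * msym (sadj i) (msym (sadj j) f)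
     - (1 - 'X_j) * msym (sadj i) (msym (sadj j) (msym (sadj i) f)))).
  have Esa := sDi f; have Eta := tDi f; have Esta := stDi f; have Esb := sDj (dbar i f).
  rewrite !E -?XB ss in Esa; rewrite !E -?XB in Eta Esta Esb; rewrite !XB in Esa Eta Esta Esb.
  by apply: (mulfI nij); exact: (braid_identityl (Di f) Esa Eta Esta (Dj _) Esb (Di _)).
have Eta := tDj f; have Esa := sDj f; have Etsa := tsDj f; have Etb := tDi (dbar j f).
rewrite !E -?XB tt in Eta; rewrite !E -?XB in Esa Etb; rewrite !E -?XB BB in Etsa.
rewrite !XB in Esa Eta Etsa Etb.
by apply/esym/(mulfI njk); exact: (braid_identityr (Dj f) Eta Esa Etsa (Di _) Etb (Dj _)).
Qed.
End DividedDifferences.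

(** * Chains of ascents *)

Section Codes.

(** Counts non-inversions starting at i, so it is the complement of the Lehmer code. The bound [K]
    allows the same lemmas to serve all n positions or only the first k. *)
Definition code (K : nat) (f : nat -> nat) (i : nat) : nat :=
  (\sum_(i.+1 <= l < K) (f i < f l))%N.

Definition swapn (j l : nat) : nat :=
  if l == j then j.+1 else if l == j.+1 then j else l.

Variables (K j : nat) (f f' : nat -> nat).
Hypothesis f'E : forall l, f' l = f (swapn j l).
Hypothesis jK : (j.+1 < K)%N.

Lemma code_swap_other i : i != j -> i != j.+1 -> code K f' i = code K f i.
Proof.
move=> ij ij1; have fi : f' i = f i by rewrite f'E /swapn (negPf ij) (negPf ij1).
have E a b : (b <= j)%N || (j.+1 < a)%N ->
  (\sum_(a <= l < b) (f i < f' l) = \sum_(a <= l < b) (f i < f l))%N.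
  move=> H; apply: eq_big_nat => l Hl; rewrite f'E /swapn !ifN //; lia.
rewrite /code fi; have [lij|lji] := ltnP i j; last by apply: E; lia.
rewrite !(@big_cat_nat _ _ _ j i.+1 K) /=; [|lia..]; congr addn; first by apply: E; lia.
do 2 (rewrite big_ltn 1?[in RHS]big_ltn; [|lia..]).
rewrite !f'E /swapn eqxx eqn_leq ltnn /= eqxx !addnA [(_ + (f i < f j.+1))%N]addnC.
by congr addn; apply: E; lia.
Qed.

(** Together with [code_swap_right]: a swap at an ascent exchanges the entries j and j+1 of the
    code, up to the one non-inversion formed by the pair itself, which is lost. *)
Lemma code_swap_left : (f j < f j.+1)%N -> code K f' j = code K f j.+1.
Proof.
move=> fj; rewrite /code big_ltn // !f'E /swapn eqxx eqn_leq ltnn /= eqxx.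
rewrite ltnNge ltnW // add0n; apply: eq_big_nat => l Hl; rewrite f'E /swapn !ifN //; lia.
Qed.

Lemma code_swap_right : (f j < f j.+1)%N -> code K f j = (code K f' j.+1).+1.
Proof.
move=> fj; rewrite /code big_ltn // fj add1n; congr S.
rewrite !f'E /swapn eqn_leq ltnn /= eqxx; apply: eq_big_nat => l Hl.
by rewrite f'E /swapn !ifN //; lia.
Qed.

Lemma code_ascent : (f j < f j.+1)%N -> (code K f j.+1 < code K f j)%N.
Proof.
move=> fj; rewrite /code [X in (_ < X)%N]big_ltn // fj ltnS.
by apply: leq_sum => l _; case: ltnP => // /(ltn_trans fj) ->.
Qed.

Lemma code_descent : (f j.+1 <= f j)%N -> (code K f j <= code K f j.+1)%N.
Proof.
move=> fj; rewrite /code [X in (X <= _)%N]big_ltn // ltnNge fj add0n.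
by apply: leq_sum => l _; case: ltnP => // /(leq_ltn_trans fj) ->.
Qed.

Lemma sum_code_swap : (f j < f j.+1)%N ->
  (\sum_(0 <= i < K) code K f i = (\sum_(0 <= i < K) code K f' i).+1)%N.
Proof.
move=> fj; rewrite !(@big_cat_nat _ _ _ j 0 K) /=; [|lia..].
rewrite -addnS; congr addn.
  by apply: eq_big_nat => i Hi; rewrite code_swap_other //; lia.
do 2 (rewrite big_ltn 1?[in RHS]big_ltn; [|lia..]).
rewrite code_swap_left // code_swap_right // addSn addnCA; congr (_ + (_ + _)).+1.
by apply: eq_big_nat => i Hi; rewrite code_swap_other //; lia.
Qed.

End Codes.

Section Diamond.
Variable n : nat.
Implicit Types (w v : 'S_n) (i j : 'I_n).

Definition wn w (l : nat) : nat := oapp (fun o : 'I_n => w o : nat) 0%N (insub l).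

Lemma wnE w i : wn w i = w i.
Proof. by rewrite /wn insubT //= => h; congr (nat_of_ord (w _)); apply/val_inj. Qed.

Lemma wn_rmul w j l : (j.+1 < n)%N -> wn (rmul w j) l = wn w (swapn j l).
Proof.
move=> jn; have js := val_succ_ord jn.
have [ln|nl] := ltnP l n; last first.
  by rewrite /wn !insubF // /swapn; do 2?case: ifP; lia.
rewrite -[l]/(val (Ordinal ln)) wnE /rmul permM /sadj.
case: tpermP => [->|->|/eqP h1 /eqP h2].
- by rewrite -wnE /swapn js eqxx.
- by rewrite -wnE /= js /swapn eqxx ifN //; lia.
- by rewrite -wnE /swapn; move: h1 h2; rewrite -!val_eqE /= js => /negPf -> /negPf ->.
Qed.

Lemma ascentE w j : ascent w j = (j.+1 < n)%N && (wn w j < wn w j.+1)%N.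
Proof.
rewrite /ascent; case: ltnP => //= h.
by rewrite -(val_succ_ord h) !wnE.
Qed.

Lemma ninvE w : ninv w = (\sum_(0 <= i < n) code n (wn w) i)%N.
Proof.
rewrite /ninv -sum1dep_card big_mkord.
rewrite -(@pair_big_dep _ _ _ _ _ xpredT (fun i l : 'I_n => (i < l)%N && (w i < w l)%N) (fun _ _ => 1%N)) /=.
apply: eq_bigr => i _; rewrite /code big_geq_mkord /= big_mkcondr [RHS]big_mkcond big_mkcond /=.
by apply: eq_bigr => l _; rewrite !wnE; case: (w i < w l)%N.
Qed.

Lemma ninv_rmul w j : ascent w j -> ninv w = (ninv (rmul w j)).+1.
Proof.
rewrite ascentE !ninvE => /andP[jn h]; apply: (@sum_code_swap _ j) => // l.
by rewrite wn_rmul.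
Qed.

Lemma groth_step w i : ascent w i ->
  exists2 j, ascent w j & groth w = dbar j (groth (rmul w j)).
Proof.
move=> wi; rewrite /groth (ninv_rmul wi) /=; case: pickP => [j wj|/(_ i)]; last by rewrite wi.
by exists j => //; move: (ninv_rmul wj); rewrite (ninv_rmul wi) => -[->].
Qed.

Lemma groth_no_ascent w : (forall j, ~~ ascent w j) -> groth w = groth_top n.
Proof.
move=> h; rewrite /groth; case: ninv => //= m; case: pickP => // j.
by rewrite (negPf (h j)).
Qed.

(* The recursion in [groth] picks one ascent; the commutation and braid relations
   make every choice give the same polynomial. *)
Lemma groth_ascent w j : ascent w j -> groth w = dbar j (groth (rmul w j)).
Proof.
have [m] := ubnP (ninv w); elim: m w j => // m IH w j; rewrite ltnS => wm wj.
have [i wi E] := groth_step wj; rewrite E {E}.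
have IHi a : ascent (rmul w i) a -> groth (rmul w i) = dbar a (groth (rmul (rmul w i) a)).
  by apply: IH; move: (ninv_rmul wi); lia.
have IHj a : ascent (rmul w j) a -> groth (rmul w j) = dbar a (groth (rmul (rmul w j) a)).
  by apply: IH; move: (ninv_rmul wj); lia.
have IHij a b : ascent (rmul w a) b -> ascent w a -> ascent (rmul (rmul w a) b) a ->
    groth (rmul (rmul w a) b) = dbar a (groth (rmul (rmul (rmul w a) b) a)).
  by move=> ab wa; apply: IH; move: (ninv_rmul wa) (ninv_rmul ab); lia.
clear IH.
wlog le_ij : i j wi wj IHi IHj / (i <= j)%N => [H|].
  by case: (leqP i j) => [|/ltnW] h; [exact: H | exact/esym/H].
move: (wi) (wj); rewrite !ascentE => /andP[iltn hi] /andP[jltn hj].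
have [ij|far|adj] : [\/ i = j, (i.+1 < j)%N | j = i.+1 :> nat].
  have [E|ne] := eqVneq i j; first by constructor 1.
  move: ne; rewrite -val_eqE /= => ne.
  by have [?|?] := ltnP i.+1 j; [constructor 2 | constructor 3; lia].
- by rewrite ij.
(* Distant ascents survive each other's swap, so both chains continue to the same permutation and
   [dbar_commute] applies. *)
- have aij : ascent (rmul w i) j.
    by rewrite ascentE jltn !wn_rmul // /swapn !ifN //; lia.
  have aji : ascent (rmul w j) i.
    by rewrite ascentE iltn !wn_rmul // /swapn !ifN //; lia.
  rewrite (IHi _ aij) (IHj _ aji) (dbar_commute _ far jltn).
  by rewrite /rmul !mulgA (sadj_commute far jltn).
(* Here [w] increases at the three positions i, i+1, i+2, so both sides of the braid relation are
   chains of ascents ending at the same permutation. *)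
- have swi v l := @wn_rmul v i l iltn; have swj v l := @wn_rmul v j l jltn.
  rewrite adj in hj.
  have S0 : swapn i i = i.+1 by rewrite /swapn eqxx.
  have S1 : swapn i i.+1 = i by rewrite /swapn eqxx ifN //; lia.
  have S2 : swapn i i.+2 = i.+2 by rewrite /swapn !ifN //; lia.
  have T0 : swapn j i = i by rewrite /swapn !ifN //; lia.
  have T1 : swapn j i.+1 = i.+2 by rewrite -adj /swapn eqxx.
  have T2 : swapn j i.+2 = i.+1 by rewrite -adj /swapn eqxx ifN //; lia.
  have hij := ltn_trans hi hj.
  have E := (swi, swj, S0, S1, S2, T0, T1, T2, hi, hj, hij).
  have a1 : ascent (rmul w i) j by rewrite ascentE jltn adj !E.
  have a2 : ascent (rmul (rmul w i) j) i by rewrite ascentE iltn !E.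
  have b1 : ascent (rmul w j) i by rewrite ascentE iltn !E.
  have b2 : ascent (rmul (rmul w j) i) j by rewrite ascentE jltn adj !E.
  rewrite (IHi _ a1) (IHj _ b1) (IHij _ _ a1 wi a2) (IHij _ _ b1 wj b2) (dbar_braid _ adj jltn).
  by rewrite /rmul !mulgA (sadj_braid adj jltn).
Qed.
End Diamond.

(** * Dominant permutations and first ascents *)

Section Steep.

(* For K = n this says that w is dominant; for K = k it keeps the x-exponents of the
   alternating sum in [alt_groth] in step. Passing the first ascent preserves it. *)
Definition steep (K : nat) (f : nat -> nat) : Prop :=
  forall i, (i.+1 < K)%N -> (code K f i <= (code K f i.+1).+1)%N.

Lemma code_descending (K : nat) (f : nat -> nat) :
  (forall i, (i.+1 < K)%N -> (f i.+1 <= f i)%N) -> forall i, code K f i = 0%N.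
Proof.
move=> /descending_leq h i; rewrite /code big_nat big1 // => l /andP[il lK].
by rewrite ltnNge h // ltnW.
Qed.

Lemma first_ascentP (K : nat) (f : nat -> nat) :
  (forall i, (i.+1 < K)%N -> (f i.+1 <= f i)%N) \/
  exists j, [/\ (j.+1 < K)%N, (f j < f j.+1)%N &
                forall i, (i < j)%N -> (f i.+1 <= f i)%N].
Proof.
have [/existsP ex|/existsPn no] := boolP [exists j : 'I_K, (j.+1 < K)%N && (f j < f j.+1)%N].
  right; have ex' : exists j, (j.+1 < K)%N && (f j < f j.+1)%N by case: ex => j; exists j.
  case: (ex_minnP ex') => j /andP[jK fj] jmin; exists j; split=> // i ij.
  rewrite leqNgt; apply/negP => fi; have := jmin i; rewrite fi; lia.
left=> i iK; have := no (Ordinal (ltnW iK)); rewrite iK /=; lia.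
Qed.

(** At an ascent the code drops strictly, and steepness allows a drop of at most 1; so the swap
    merely lowers entry j by one and makes entries j and j+1 equal. The position before j is a
    descent, hence its code is at most the old entry j, and steepness survives. *)
Lemma steep_swap (K j : nat) (f f' : nat -> nat) :
  (forall l, f' l = f (swapn j l)) -> (j.+1 < K)%N -> (f j < f j.+1)%N ->
  (forall i, (i < j)%N -> (f i.+1 <= f i)%N) -> steep K f ->
  [/\ steep K f', forall i, code K f i = (code K f' i + (i == j))%N
    & code K f' j = code K f' j.+1].
Proof.
move=> f'E jK fj below st.
have cj : code K f j = (code K f j.+1).+1.
  by have := st _ jK; have := code_ascent jK fj; lia.
have c'j := code_swap_left f'E jK fj.
have c'j1 := code_swap_right f'E jK fj.
have c'i := code_swap_other f'E jK.
have E i : code K f i = (code K f' i + (i == j))%N.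
  have [->|ij] := eqVneq i j; first by rewrite addn1 cj c'j.
  by have [->|ij1] := eqVneq i j.+1; [lia | rewrite addn0 c'i].
split=> //; last by lia.
move=> i iK; have := st _ iK; rewrite !E.
have [ij1|ij1] := eqVneq i.+1 j; last by lia.
by subst j; have := code_descent iK (below i (ltnSn i)); rewrite !E; lia.
Qed.

Lemma code_leq (K : nat) (f : nat -> nat) i : (code K f i <= K - i.+1)%N.
Proof.
rewrite /code -[X in (_ <= X)%N]muln1 -sum_nat_const_nat.
by apply: leq_sum => l _; case: (_ < _)%N.
Qed.

End Steep.

Section Dominant.
Variable n : nat.
Implicit Types (w v : 'S_n) (i j : 'I_n) (f g h : {mpoly int[n]}).

Lemma dbar_X_mul j h : (j.+1 < n)%N -> msym (sadj j) h = h -> dbar j ('X_j * h) = h.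
Proof.
move=> jn sh; apply: (mulfI (X_sub_succ_neq0 jn)).
by rewrite dbarE msymM sh msym_X tpermL; ring.
Qed.

Lemma msym_sadj_X j (m : 'X_{1..n}) : m j = m (succ_ord j) ->
  msym (sadj j) 'X_[m] = 'X_[m] :> {mpoly int[n]}.
Proof.
move=> mj; rewrite msymX; congr mpolyX; apply/mnmP => i.
by rewrite mnmE tpermV /sadj; case: tpermP => [->|->|].
Qed.

(** By [code_leq] the subtraction is exact: the exponents count inversions. *)
Definition lehmer w : 'X_{1..n} := [multinom (n - i.+1 - code n (wn w) i)%N | i < n].

(** Induction along first ascents, starting from the decreasing permutation. The swap adds one
    ['X_j] to a monomial symmetric in the variables j and j+1, and [dbar_X_mul] removes it again. *)
Lemma groth_dominant w : steep n (wn w) -> groth w = 'X_[lehmer w].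
Proof.
have [m] := ubnP (ninv w); elim: m w => // m IH w; rewrite ltnS => wm st.
have [desc|[j [jn wj below]]] := first_ascentP n (wn w).
  rewrite groth_no_ascent => [|j]; last by rewrite ascentE; case: ltnP => //= /desc; lia.
  rewrite mpolyXE_id; apply: eq_bigr => i _.
  by rewrite mnmE code_descending // subn0; congr (_ ^+ _); lia.
pose o := Ordinal (ltnW jn); have wo : ascent w o by rewrite ascentE jn.
have on : (o.+1 < n)%N by [].
have [st' E E1] := steep_swap (fun l => wn_rmul w l on) jn wj below st.
rewrite (groth_ascent wo) IH //; last by have := ninv_rmul wo; lia.
suff -> : lehmer (rmul w o) = (U_(o) + lehmer w)%MM.
  rewrite mpolyXD dbar_X_mul // msym_sadj_X // !mnmE val_succ_ord //.
  by move: E1 (E j) (E j.+1) (code_leq n (wn w) j); rewrite eqxx /=; lia.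
apply/mnmP => i; rewrite mnmDE mnm1E !mnmE E.
have := E i; have := code_leq n (wn w) i; rewrite -val_eqE /= eq_sym; lia.
Qed.

End Dominant.

(** * Alternating sums over the symmetric group of the first k variables *)

Definition below (n k : nat) : {set 'I_n} := [set i : 'I_n | (i < k)%N].

Lemma perm_on_sadj (n k : nat) (j : 'I_n) :
  (j.+1 < k)%N -> (j.+1 < n)%N -> perm_on (below n k) (sadj j).
Proof.
move=> jk jn; apply/subsetP => i; rewrite !inE /sadj.
by case: tpermP => [->|->|]; rewrite ?eqxx // ?val_succ_ord //; lia.
Qed.

Section Alternation.
Variables (n k : nat).
Implicit Types (w v : 'S_n) (i j : 'I_n) (f g h p r : {mpoly int[n]}).

Local Notation K := (below n k).

Definition alt f : {mpoly int[n]} := \sum_(s : 'S_n | perm_on K s) (-1) ^+ s * msym s f.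

Lemma alt_msym t f : perm_on K t -> alt (msym t f) = (-1) ^+ t * alt f.
Proof.
move=> Kt; rewrite /alt (reindex_inj (mulgI t^-1%g)) mulr_sumr /=.
apply: eq_big => [s|s _].
  apply/idP/idP => [H|H]; last by rewrite perm_onM // perm_onV.
  by rewrite -[s](mulKVg t); apply: perm_onM.
by rewrite -msymMm mulKVg odd_permM odd_permV signr_addb mulrA.
Qed.

Lemma altB f g : alt (f - g) = alt f - alt g.
Proof. by rewrite -sumrB; apply: eq_bigr => s _; rewrite msymB mulrBr. Qed.

Lemma altM_sym f g : (forall s, perm_on K s -> msym s g = g) -> alt (f * g) = alt f * g.
Proof.
by move=> h; rewrite /alt mulr_suml; apply: eq_bigr => s /h E; rewrite msymM E mulrA.
Qed.

(* The two sides differ by [alt] of an [s_j]-invariant polynomial. *)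
Lemma alt_dbar j r g : (j.+1 < k)%N -> (j.+1 < n)%N -> msym (sadj j) r = r ->
  alt ('X_j * ((1 - 'X_(succ_ord j)) * r) * dbar j g) = alt ((1 - 'X_(succ_ord j)) * r * g).
Proof.
move=> jk jn sr; apply/eqP; rewrite -subr_eq0 -altB; set u := (X in alt X).
have su : msym (sadj j) u = u.
  rewrite /u !(msymM, msymB, msym1) !msym_X tpermL tpermR sr msym_dbar.
  by apply: (eq_lin (eq_scale (- r) (dbarE j g))); ring.
(* Invariance gives [alt u = - alt u], hence [alt u = 0] because the integers have no 2-torsion. *)
have := alt_msym u (perm_on_sadj jk jn); rewrite su /sadj odd_tperm succ_ord_neq //.
rewrite expr1 mulN1r => /eqP; rewrite -addr_eq0 -mulr2n -mulr_natl mulf_eq0.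
by rewrite -(rmorph_nat (@mpolyC n int)) mpolyC_eq0.
Qed.

(** Adjacent transpositions generate: multiplying by them moves the image of the last index up until
    that index is fixed, and then k decreases. *)
Lemma msym_generated f : (k <= n)%N ->
  (forall j, (j.+1 < k)%N -> msym (sadj j) f = f) ->
  forall s, perm_on K s -> msym s f = f.
Proof.
elim: k => [|k' IH] kn sf s Ks.
  have -> : s = 1%g; last by rewrite msym1m.
  by apply: (perm_on_id Ks); rewrite [X in #|pred_of_set X|](_ : _ = set0) ?cards0 //; apply/setP => i; rewrite !inE.
pose o := Ordinal kn; have [m] := ubnP (k' - s o)%N; elim: m s Ks => // m IHm s Ks.
have so : (s o <= k')%N.
  by have := perm_closed o Ks; rewrite !inE !ltnS leqnn.
have [E|ne] := eqVneq (s o) o.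
  move=> _; apply: IH; [exact: ltnW | by move=> j /ltnW; apply: sf |].
  apply/subsetP => i si; have := subsetP Ks i si; rewrite !inE ltnS leq_eqVlt.
  case/predU1P => // ik; move: si; rewrite inE; have -> : i = o by apply/val_inj.
  by rewrite E eqxx.
have lt : (s o < k')%N by rewrite ltn_neqAle so andbT.
have ltn : ((s o).+1 < n)%N by lia.
move=> sm; have {1}-> : s = (s * sadj (s o) * sadj (s o))%g by rewrite -mulgA tperm2 mulg1.
have Kj := perm_on_sadj (lt : ((s o).+1 < k'.+1)%N) ltn.
rewrite msymMm IHm ?sf //; first exact: perm_onM.
by rewrite permM tpermL val_succ_ord //; lia.
Qed.

(** With [b = id] this is the diagonal term of the determinant [bialt], as [alt_mon_bialt] makes
    precise. *)
Definition mon (a b : nat -> nat) : {mpoly int[n]} :=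
  \prod_(i < n | (i < k)%N) ('X_i ^+ a i * (1 - 'X_i) ^+ b i).

Lemma eq_mon a a' b b' : (forall i : nat, (i < k)%N -> a i = a' i) ->
  (forall i : nat, (i < k)%N -> b i = b' i) -> mon a b = mon a' b'.
Proof. by move=> ea eb; apply: eq_bigr => i ik; rewrite ea ?eb. Qed.

Lemma mon_incl (a b : nat -> nat) j : (j < k)%N -> mon (fun i : nat => a i + (i == j))%N b = 'X_j * mon a b.
Proof.
move=> jk; rewrite /mon (bigD1 j) //= [in RHS](bigD1 j) //= eqxx addn1 exprS -!mulrA.
rewrite (eq_bigr (fun i : 'I_n => 'X_i ^+ a i * (1 - 'X_i) ^+ b i)) //.
by move=> i /andP[_ /negPf]; rewrite -val_eqE /= => ->; rewrite addn0.
Qed.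

Lemma mon_incr (a b : nat -> nat) j : (j < k)%N -> mon a (fun i : nat => b i + (i == j))%N = (1 - 'X_j) * mon a b.
Proof.
move=> jk; rewrite /mon (bigD1 j) //= [in RHS](bigD1 j) //= eqxx addn1 exprS mulrCA -!mulrA.
rewrite (eq_bigr (fun i : 'I_n => 'X_i ^+ a i * (1 - 'X_i) ^+ b i)) //.
by move=> i /andP[_ /negPf]; rewrite -val_eqE /= => ->; rewrite addn0.
Qed.

Lemma msym_mon (a b : nat -> nat) j : (j.+1 < k)%N -> (j.+1 < n)%N -> a j = a j.+1 -> b j = b j.+1 ->
  msym (sadj j) (mon a b) = mon a b.
Proof.
move=> jk jn aj bj; rewrite /mon rmorph_prod /= [RHS](reindex_inj (@perm_inj _ (sadj j))) /=.
have E (i : 'I_n) : [/\ (sadj j i < k)%N = (i < k)%N, a (sadj j i) = a i & b (sadj j i) = b i].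
  rewrite /sadj; case: tpermP => [->|->|//]; rewrite val_succ_ord //.
  - by split=> //; lia.
  - by split=> //; lia.
apply: eq_big => i; first by case: (E i).
by move=> _; case: (E i) => _ -> ->; rewrite rmorphM !rmorphXn /= msymB msym1 msym_X.
Qed.

(** Each swap at a first ascent lowers the code by one at j. The corresponding factor ['X_j] of the
    monomial is the one that [alt_dbar] consumes together with the operator [dbar j]. *)
Lemma alt_groth w : (k <= n)%N -> steep k (wn w) ->
  exists v, [/\ forall i : nat, (k <= i)%N -> wn v i = wn w i,
    forall i : nat, (i.+1 < k)%N -> (wn v i.+1 <= wn v i)%N &
    alt (mon (code k (wn w)) id * groth w) = alt (mon (fun=> 0%N) id * groth v)].
Proof.
move=> kn; have [m] := ubnP (\sum_(0 <= i < k) code k (wn w) i)%N.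
elim: m w => // m IH w; rewrite ltnS => wm st.
have [desc|[j [jk wj low]]] := first_ascentP k (wn w).
  exists w; split=> //; congr (alt (_ * _)).
  by apply: eq_mon => // i _; rewrite code_descending.
have jn : (j.+1 < n)%N by apply: leq_trans kn.
pose o := Ordinal (ltnW jn); have wo : ascent w o by rewrite ascentE jn.
have E0 l : wn (rmul w o) l = wn w (swapn j l) by apply: wn_rmul.
have [st' E E1] := steep_swap E0 jk wj low st.
have [v [v1 v2 v3]] : exists v, [/\ forall i : nat, (k <= i)%N -> wn v i = wn (rmul w o) i,
    forall i : nat, (i.+1 < k)%N -> (wn v i.+1 <= wn v i)%N &
    alt (mon (code k (wn (rmul w o))) id * groth (rmul w o)) = alt (mon (fun=> 0%N) id * groth v)].
  by apply: IH => //; have := sum_code_swap E0 jk wj; lia.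
exists v; split=> // [i ki|].
  by rewrite v1 // E0 /swapn !ifN //; lia.
rewrite -v3 (groth_ascent wo).
have js : succ_ord o = j.+1 :> nat by apply: val_succ_ord.
rewrite (eq_mon (a' := fun i : nat => (code k (wn (rmul w o)) i + (i == o))%N) (b' := id)) //.
rewrite mon_incl //=; last exact: ltnW.
(* Removing one factor [1 - 'X_(succ_ord o)] leaves the exponent j on both [1 - x_j] and
   [1 - x_(j+1)]; the x-exponents agree by [E1], so the remaining product is invariant as [alt_dbar]
   requires. *)
have -> : mon (code k (wn (rmul w o))) id = (1 - 'X_(succ_ord o)) *
    mon (code k (wn (rmul w o))) (fun i : nat => i - (i == succ_ord o))%N.
  by rewrite -mon_incr js //; apply: eq_mon => // i _; case: eqP => /= [->|_]; lia.
apply: alt_dbar => //; apply: msym_mon => //.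
by rewrite js /= eqxx; case: eqP => [|_]; lia.
Qed.

End Alternation.

(** * The bialternant formula and branching *)

Section Bialternant.
Variable R : comNzRingType.
Implicit Types (x : nat -> R) (a la : nat -> nat).

Definition bialt (k : nat) a x : R :=
  \det (\matrix_(i < k, j < k) (x j ^+ a i * (1 - x j) ^+ i)).

(** Multilinearity in the rows. The choice of one summand in every row will become the choice of a
    shape [mu]. *)
Lemma det_sum_rows k (I : finType) (Q : 'I_k -> pred I) (c : 'I_k -> I -> R)
    (psi : 'I_k -> I -> 'I_k -> R) :
  \det (\matrix_(i < k, j < k) \sum_(m | Q i m) c i m * psi i m j) =
  \sum_(mu in family Q) (\prod_i c i (mu i)) * \det (\matrix_(i, j) psi i (mu i) j).
Proof.
rewrite /determinant.
under eq_bigr => s _.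
  under eq_bigr => i _ do rewrite mxE.
  rewrite bigA_distr_big_dep mulr_sumr.
  over.
rewrite exchange_big /=; apply: eq_bigr => mu _; rewrite mulr_sumr; apply: eq_bigr => s _.
by rewrite big_split /= mulrCA; congr (_ * (_ * _)); apply: eq_bigr => i _; rewrite mxE.
Qed.

(** The right-hand side is an entry of the reduced matrix up to common factors. The quotient by
    [x - z] lists the possible row lengths m, with a factor [1 - z] exactly when the row has a
    corner. *)
Lemma telescoping_strip (x z : R) (a b : nat) : (b <= a)%N ->
  (x - z) * (\sum_(b <= m < a.+1) (1 - z) ^+ (b < m) * z ^+ (a - m) * x ^+ m) =
  x ^+ a.+1 * (1 - z) - z ^+ (a - b).+1 * x ^+ b * (1 - x).
Proof.
move=> /subnKC <-; elim: (a - b)%N => [|d IH].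
  by rewrite addn0 big_nat1 ltnn !subnn !expr0 expr1 exprS; ring.
rewrite addnS big_nat_recr /=; last by lia.
have -> : (\sum_(b <= m < (b + d).+1) (1 - z) ^+ (b < m) * z ^+ ((b + d).+1 - m) * x ^+ m =
    z * \sum_(b <= m < (b + d).+1) (1 - z) ^+ (b < m) * z ^+ (b + d - m) * x ^+ m).
  rewrite mulr_sumr; apply: eq_big_nat => m Hm.
  have -> : ((b + d).+1 - m = (b + d - m).+1)%N by lia.
  by rewrite exprS; ring.
rewrite ltnS leq_addr subnn expr0 expr1 mulr1 mulrDr mulrCA IH.
have -> : ((b + d).+1 - b = (b + d - b).+1)%N by lia.
by rewrite !exprS; ring.
Qed.

Definition stair (k : nat) la (i : nat) : nat := (la i + (k - i.+1))%N.

(** Row lengths are bounded by [N] so that shapes form a finite type over which sums can range; rows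
    from k on are empty. *)
Definition ext (k N : nat) (mu : {ffun 'I_k -> 'I_N}) (i : nat) : nat :=
  oapp (fun o : 'I_k => mu o : nat) 0%N (insub i).

Lemma extE k N (mu : {ffun 'I_k -> 'I_N}) (i : 'I_k) : ext mu i = mu i.
Proof. by rewrite /ext insubT //= => h; congr (nat_of_ord (mu _)); apply/val_inj. Qed.

Definition strip (N : nat) la (i : nat) : pred 'I_N :=
  fun m => (la i.+1 <= m <= la i)%N.

Definition strip_size (k N : nat) la (mu : {ffun 'I_k -> 'I_N}) : nat :=
  (la k + \sum_(i < k) (la i - mu i))%N.

Definition strip_corners (k N : nat) la (mu : {ffun 'I_k -> 'I_N}) : nat :=
  (\sum_(i < k) (la i.+1 < mu i))%N.

(** The factor on the left is the determinant of the column operations, the one on the right comes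
    from the last diagonal entry. Both are kept because [R] is not assumed to be a domain. *)
Lemma bialt_branch k N la x :
  (forall i, (i < k)%N -> (la i.+1 <= la i)%N) -> (la 0 < N)%N ->
  bialt k.+1 (stair k.+1 la) x * (1 - x k) ^+ k = (1 - x k) ^+ k *
  ((\prod_(i < k) (x i - x k)) * \sum_(mu in family (fun i : 'I_k => strip (N := N) la i))
    (1 - x k) ^+ strip_corners la mu * x k ^+ strip_size la mu * bialt k (stair k (ext mu)) x).
Proof.
move=> dec laN; set z := x k.
have laN' i : (i <= k)%N -> (la i < N)%N.
  by elim: i => // i IH ik; apply: leq_ltn_trans (dec _ ik) (IH (ltnW ik)).
pose M : 'M[R]_k.+1 := \matrix_(i, j) (x i ^+ stair k.+1 la j * (1 - x i) ^+ j).
(* Column j becomes [1 - z] times itself minus [z ^+ (la j - la j.+1).+1] times column j+1, which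
   makes it vanish at [x = z]. *)
pose C : 'M[R]_k.+1 := \matrix_(i, j) if i == j then (if (j < k)%N then 1 - z else 1)
  else if i == j.+1 :> nat then - z ^+ (la j - la j.+1).+1 else 0.
pose S (j : 'I_k) (t : R) := \sum_(m < N | strip (N := N) la j m)
  (1 - z) ^+ (la j.+1 < m)%N * z ^+ (la j - m) * (t ^+ (m + (k - j.+1)) * (1 - t) ^+ j).
have detC : \det C = (1 - z) ^+ k.
  rewrite det_trig; last by apply/is_trig_mxP => i j ij; rewrite mxE -val_eqE /= !ifN //; lia.
  rewrite big_ord_recr /= mxE eqxx ltnn mulr1.
  rewrite (eq_bigr (fun=> 1 - z)) ?prodr_const ?card_ord // => i _.
  by rewrite mxE eqxx /= ltn_ord.
have MC i (j : 'I_k) : (M *m C) i (widen_ord (leqnSn k) j) = (x i - z) * S j (x i).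
  have jk := ltn_ord j.
  pose j1 : 'I_k.+1 := Ordinal (ltn_ord j : (j.+1 < k.+1)%N).
  rewrite mxE (bigD1 (widen_ord (leqnSn k) j)) //= (bigD1 j1) /=; last first.
    by rewrite -val_eqE /=; lia.
  rewrite big1 ?addr0; last first.
    move=> l /andP[l1 l2]; rewrite !mxE ifN // ifN ?mulr0 //.
  have e1 : (j1 == widen_ord (leqnSn k) j) = false by rewrite -val_eqE /=; lia.
  rewrite !mxE eqxx e1 /= jk eqxx.
  have -> : S j (x i) = x i ^+ (k - j.+1) * (1 - x i) ^+ j *
     \sum_(la j.+1 <= m < (la j).+1) (1 - z) ^+ (la j.+1 < m)%N * z ^+ (la j - m) * x i ^+ m.
    rewrite /S (big_nat_widen _ _ N) ?laN' 1?ltnW // big_geq_mkord mulr_sumr /=.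
    by apply: eq_big => m; [rewrite /strip ltnS andbC | move=> _; rewrite exprD; ring].
  rewrite mulrCA telescoping_strip ?dec // /stair.
  have -> : (k.+1 - j.+1 = (k - j.+1).+1)%N by lia.
  rewrite subSS !exprD !exprS; ring.
rewrite -[bialt _ _ _]det_tr; have -> : ((\matrix_(i < k.+1, j < k.+1)
    (x j ^+ stair k.+1 la i * (1 - x j) ^+ i))^T = M)%R.
  by apply/matrixP => i j; rewrite !mxE.
(* The last row belongs to the variable [z], so only its last entry survives, and the minor has a
   factor [x i - z] in each row. *)
rewrite -detC -det_mulmx detC (expand_det_row _ ord_max) big_ord_recr /= big1; last first.
  by move=> j _; rewrite MC /= subrr !mul0r.
have widen_lift (i : 'I_k) : lift ord_max i = widen_ord (leqnSn k) i.
  by apply/val_inj; rewrite /= /bump leqNgt ltn_ord.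
rewrite add0r /cofactor addnn -signr_odd odd_double expr0 mul1r.
have -> : (M *m C) ord_max ord_max = z ^+ la k * (1 - z) ^+ k.
  rewrite mxE big_ord_recr /= big1 ?add0r => [|l _].
    by rewrite !mxE eqxx ltnn mulr1 /stair subnn addn0.
  by rewrite !mxE -val_eqE /= !ifN ?mulr0 //; have := ltn_ord l; lia.
have -> : row' ord_max (col' ord_max (M *m C)) =
    diag_mx (\row_(i < k) (x i - z)) *m \matrix_(i, j) S j (x i).
  by apply/matrixP => i j; rewrite mul_diag_mx 2!mxE !widen_lift MC !mxE.
rewrite det_mulmx det_diag -[X in _ * (_ * X)]det_tr.
have -> : ((\matrix_(i, j) S j (x i))^T = \matrix_(i < k, j < k) S i (x j))%R.
  by apply/matrixP => i j; rewrite !mxE.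
rewrite /S det_sum_rows mulrCA -mulrA.
rewrite (eq_bigr (fun i : 'I_k => x i - z)) => [|i _]; last by rewrite mxE.
rewrite [RHS]mulrCA; congr (_ * _); rewrite mulrCA; congr (_ * _).
rewrite mulr_sumr; apply: eq_bigr => mu _; rewrite big_split /= !prodrXr mulrA; congr (_ * _).
  by rewrite /strip_size /strip_corners exprD; ring.
by congr (\det _); apply/matrixP => i j; rewrite !mxE /stair extE.
Qed.

End Bialternant.

Section GrothendieckSymmetric.
Variable n : nat.
Implicit Types (w v : 'S_n) (la : nat -> nat).

Definition xn (i : nat) : {mpoly int[n]} := oapp (fun o : 'I_n => 'X_o) 0 (insub i).

Lemma xnE (i : 'I_n) : xn i = 'X_i.
Proof. by rewrite /xn insubT //= => h; congr mpolyX; congr U_(_)%MM; apply/val_inj. Qed.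

(* Branching over the largest entry k of set-valued tableaux: [mu] collects the cells
   with an entry less than k, and any subset of the [strip_corners] corners of [mu] may
   contain k as well. *)
Fixpoint sgroth (N k : nat) la : {mpoly int[n]} :=
  if k is k'.+1 then
    \sum_(mu : {ffun 'I_k' -> 'I_N} | mu \in family (fun i : 'I_k' => strip (N := N) la i))
      (1 - xn k') ^+ strip_corners la mu * xn k' ^+ strip_size la mu * sgroth N k' (ext mu)
  else 1.

Lemma eq_sgroth N k la la' : (forall i, (i < k)%N -> la i = la' i) ->
  sgroth N k la = sgroth N k la'.
Proof.
case: k => //= k E; apply: eq_big => [mu|mu _].
  have F (i : 'I_k) : strip (N := N) la i =1 strip (N := N) la' i.
    by move=> m; rewrite /strip !E //; have := ltn_ord i; lia.
  by apply/familyP/familyP => h i; have := h i; rewrite /in_mem /= F.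
congr (_ ^+ _ * _ ^+ _ * _); first by apply: eq_bigr => i _; rewrite E //; have := ltn_ord i; lia.
rewrite /strip_size E //; congr addn; apply: eq_bigr => i _; rewrite E //; have := ltn_ord i; lia.
Qed.

(** Through [bialt_sgroth], this identifies the denominator of the bialternant formula with
    [vdm k]. *)
Lemma sgroth0 N k : (0 < N)%N -> sgroth N k (fun=> 0%N) = 1.
Proof.
move=> N0; elim: k => //= k IH; pose mu0 : {ffun 'I_k -> 'I_N} := [ffun=> Ordinal N0].
rewrite (big_pred1 mu0) => [|mu].
  rewrite /strip_corners /strip_size !big1 ?addn0 ?expr0 ?mul1r => [|i _|i _]; rewrite ?ffunE //.
  by rewrite -[RHS]IH; apply: eq_sgroth => i ik; rewrite -[i]/(val (Ordinal ik)) extE ffunE.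
apply/familyP/eqP => [h|-> i]; last by rewrite ffunE.
apply/ffunP => i; apply/val_inj; have := h i.
by rewrite ffunE /in_mem /= /strip leqn0 => /eqP.
Qed.

Definition vdm (k : nat) : {mpoly int[n]} := \prod_(j < k) \prod_(i < j) (xn i - xn j).

Lemma vdm_neq0 k : (k <= n)%N -> vdm k != 0.
Proof.
move=> kn; apply/prodf_neq0 => j _; apply/prodf_neq0 => i _.
have jn : (j < n)%N := leq_trans (ltn_ord j) kn.
have iN := ltn_trans (ltn_ord i) jn.
rewrite -[nat_of_ord j]/(val (Ordinal jn)) -[nat_of_ord i]/(val (Ordinal iN)) !xnE.
by apply: mpolyX_sub_neq0; rewrite -val_eqE /= neq_ltn ltn_ord.
Qed.

(** Both sides obey the same branching rule once [(1 - xn k) ^+ k] is cancelled, which is legitimate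
    over the integers since its base has constant term 1. *)
Lemma bialt_sgroth N k la : (k <= n)%N ->
  (forall i, (i.+1 < k)%N -> (la i.+1 <= la i)%N) -> (la 0 < N)%N ->
  bialt k (stair k la) xn = vdm k * sgroth N k la.
Proof.
elim: k la => [|k IH] la kn dec laN.
  by rewrite /bialt det_mx00 /vdm big_ord0 mul1r.
have zn : (1 - xn k) ^+ k != 0.
  rewrite expf_neq0 // -[k]/(val (Ordinal kn)) xnE; apply/eqP => /(congr1 (mcoeff 0%MM)).
  by rewrite mcoeffB mcoeff1 mcoeffX eqxx mnm1_eq0 subr0 mcoeff0.
apply: (mulIf zn); rewrite (bialt_branch _ _ laN); last by move=> i ik; apply: dec.
rewrite [RHS]mulrC; congr (_ * _).
rewrite /vdm big_ord_recr /= -/(vdm k) [vdm k * _]mulrC -[RHS]mulrA; congr (_ * _).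
rewrite [RHS]mulr_sumr; apply: eq_bigr => mu /familyP hmu.
rewrite mulrCA; congr (_ * _); apply: IH => [|i ik|].
- exact: ltnW.
- have := hmu (Ordinal (ltnW ik)); have := hmu (Ordinal ik).
  rewrite -[i.+1]/(val (Ordinal ik)) extE -[i]/(val (Ordinal (ltnW ik))) extE.
  by rewrite /in_mem /= /strip; lia.
- case: (k) mu hmu => [|k'] mu hmu; first by rewrite /ext insubF //=; apply: leq_ltn_trans laN.
  by rewrite -[0%N]/(val (@ord0 k')) extE.
Qed.

End GrothendieckSymmetric.

(** The sum [alt] runs over permutations of n indices, the determinant over those of k. Bordering
    the matrix by an identity block makes the Leibniz terms of all other permutations vanish. *)
Lemma alt_mon_bialt (n k : nat) (a : nat -> nat) : (k <= n)%N ->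
  alt k (mon n k a id) = bialt k a (xn n).
Proof.
move=> kn; have [l E] : exists l, n = (k + l)%N by exists (n - k)%N; rewrite subnKC.
subst n; rewrite /bialt; set A := (X in \det X).
have -> : \det A = \det (block_mx A 0 0 (1%:M : 'M_l)) by rewrite det_lblock det1 mulr1.
rewrite /alt big_mkcond; apply: eq_bigr => s _.
case: ifPn => [Ks|nKs].
  congr (_ * _); rewrite /mon rmorph_prod /= big_mkcond !big_split_ord /=.
  rewrite [X in _ * X]big1 ?mulr1 => [|i _]; last by rewrite ifN //; lia.
  rewrite [X in _ * X]big1 ?mulr1 => [|i _]; last first.
    have -> : s (rshift k i) = rshift k i.
      by apply: (out_perm Ks); rewrite inE /=; lia.
    by rewrite block_mxEdr mxE eqxx.
  apply: eq_bigr => i _; rewrite ltn_ord.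
  have := perm_closed (lshift l i) Ks; rewrite !inE /= ltn_ord => lt.
  have si : s (lshift l i) = lshift l (Ordinal lt) by apply/val_inj.
  rewrite rmorphM !rmorphXn /= msymB msym1 !msym_X si block_mxEul mxE.
  by rewrite -[nat_of_ord _]/(val (lshift l (Ordinal lt))) xnE.
have [i ki si] : exists2 i : 'I_(k + l), (k <= i)%N & s i != i.
  by case/subsetPn: nKs => i; rewrite !inE -leqNgt => si ki; exists i.
rewrite (bigD1 i) //=; have [i0 E] : exists i0, i = rshift k i0.
  by case: (split_ordP i) ki => [i0 -> /=|i0 ->]; [have := ltn_ord i0; lia | exists i0].
rewrite E in si *; case: (split_ordP (s (rshift k i0))) si => j ->.
  by rewrite block_mxEdl mxE mul0r mulr0.
rewrite (inj_eq (@rshift_inj _ _)) eq_sym => /negPf ji.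
by rewrite block_mxEdr mxE ji mul0r mulr0.
Qed.

Lemma code_ascending (K b : nat) (f : nat -> nat) :
  (forall i, (b <= i)%N -> (i.+1 < K)%N -> (f i < f i.+1)%N) ->
  forall i, (b <= i)%N -> code K f i = (K - i.+1)%N.
Proof.
move=> asc i bi; rewrite /code -[RHS]muln1 -sum_nat_const_nat.
apply: eq_big_nat => l /andP[il lK]; suff -> : (f i < f l)%N by [].
elim: l il lK => // l IH; rewrite ltnS leq_eqVlt => /predU1P[<-|il] lK; first exact: asc.
by apply: ltn_trans (IH il (ltnW lK)) (asc _ _ lK); lia.
Qed.

(** The code of [w] on the first k positions is the staircase, and [alt_groth] leads to a dominant
    [v]. The shape [la] is the Lehmer code of [v] minus the staircase. *)
Lemma groth_sgroth n k (w : 'S_n) : (k <= n)%N ->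
  (forall i : nat, (i.+1 < k)%N -> (wn w i < wn w i.+1)%N) ->
  (forall i : nat, (k <= i)%N -> (i.+1 < n)%N -> (wn w i < wn w i.+1)%N) ->
  exists N la, [/\ forall i, (i.+1 < k)%N -> (la i.+1 <= la i)%N, (la 0 < N)%N &
    groth w = sgroth n N k la].
Proof.
move=> kn asc1 asc2.
have codek i : (i < k)%N -> code k (wn w) i = (k - i.+1)%N.
  by move=> ik; apply: (@code_ascending _ 0) => // j _; apply: asc1.
have stk : steep k (wn w) by move=> i ik; rewrite !codek //; lia.
have [v [v1 v2 v3]] := alt_groth kn stk.
have coden i : (k <= i)%N -> code n (wn v) i = (n - i.+1)%N.
  by apply: code_ascending => j kj jn; rewrite !v1 //; [apply: asc2 | lia].
(* The code increases weakly along the first k positions, where [v] descends, and is maximal on the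
   others, where [v] ascends. *)
have stn : steep n (wn v).
  move=> i iN; have [ik|ki] := ltnP i.+1 k; first by apply/leqW/code_descent/v2.
  by rewrite (coden i.+1 ki); have := code_leq n (wn v) i; lia.
pose L i := (n - i.+1 - code n (wn v) i)%N.
have Ldec i : (i.+1 < k)%N -> (L i.+1 < L i)%N.
  move=> ik; have iN : (i.+1 < n)%N by apply: leq_trans kn.
  have := code_descent iN (v2 i ik); rewrite /L.
  by have := code_leq n (wn v) i.+1; lia.
(* Strict decrease puts [L] above the staircase, so the subtraction defining [la] is exact. *)
have Lge i : (i < k)%N -> (k - i.+1 <= L i)%N.
  have [d] := ubnP (k - i)%N; elim: d i => // d IH i id ik.
  have [ik1|ki] := ltnP i.+1 k; last by lia.
  by have := IH i.+1; have := Ldec i ik1; lia.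
pose la i := (L i - (k - i.+1))%N.
have dec i : (i.+1 < k)%N -> (la i.+1 <= la i)%N.
  by move=> ik; have := Ldec i ik; have := Lge i.+1 ik; rewrite /la; lia.
exists (la 0%N).+1, la; split=> //.
(* Since [w] ascends within the first k positions, [groth w] is symmetric in those variables and
   factors out of [alt]. *)
have sym s : perm_on (below n k) s -> msym s (groth w) = groth w.
  apply: msym_generated => // j jk.
  have jn : (j.+1 < n)%N by apply: leq_trans kn.
  have wj : ascent w j by rewrite ascentE jn asc1.
  by rewrite (groth_ascent wj) msym_dbar.
have monL : mon n k (fun=> 0%N) id * 'X_[lehmer v] = mon n k L id.
  rewrite mpolyXE_id /mon (bigID (fun i : 'I_n => (i < k)%N) xpredT) /=.
  rewrite [X in _ * (_ * X)]big1 ?mulr1 => [|i]; last first.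
    by rewrite -leqNgt => ki; rewrite mnmE coden // subnn expr0.
  by rewrite -big_split /=; apply: eq_bigr => i ik; rewrite expr0 mul1r mnmE mulrC.
move: v3; rewrite (altM_sym _ sym) (groth_dominant stn) monL.
rewrite (@eq_mon n k (code k (wn w)) (stair k (fun=> 0%N)) id id) //.
rewrite (@eq_mon n k L (stair k la) id id) //; last by move=> i ik; rewrite /stair /la; have := Lge i ik; lia.
rewrite !alt_mon_bialt // (@bialt_sgroth _ 1) // sgroth0 // mulr1.
by rewrite (@bialt_sgroth _ (la 0%N).+1) // => /(mulfI (vdm_neq0 kn)).
Qed.

(** * Supports *)

Section Signed.
Variable n : nat.
Implicit Types (f g : {mpoly int[n]}) (m : 'X_{1..n}).

(** Signs alternate with the degree; for [sgroth] the reference degree [d] is the size of the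
    shape. *)
Definition signed (d : nat) f : Prop := forall m, 0 <= (-1) ^+ (d + mdeg m) * f@_m.

Lemma sign_mul_eq0 d (x : int) : ((-1) ^+ d * x == 0) = (x == 0).
Proof. by rewrite mulf_eq0 signr_eq0. Qed.

(* Same-sign terms cannot cancel. *)
Lemma signed_sum (I : finType) (P : pred I) (F : I -> {mpoly int[n]}) d :
  (forall i, P i -> signed d (F i)) -> signed d (\sum_(i | P i) F i).
Proof. by move=> sF m; rewrite raddf_sum /= mulr_sumr sumr_ge0 // => i /sF. Qed.

Lemma msupp_signed_sum (I : finType) (P : pred I) (F : I -> {mpoly int[n]}) d :
  (forall i, P i -> signed d (F i)) ->
  forall m, m \in msupp (\sum_(i | P i) F i) <-> exists2 i, P i & m \in msupp (F i).
Proof.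
move=> sF m; rewrite mcoeff_msupp raddf_sum /= -(sign_mul_eq0 (d + mdeg m)) mulr_sumr.
rewrite psumr_eq0 => [|i /sF //]; rewrite -has_predC; split=> [/hasP[i _ /=]|[i Pi mi]].
  by rewrite negb_imply sign_mul_eq0 -mcoeff_msupp => /andP[Pi mi]; exists i.
by apply/hasP; exists i; rewrite ?mem_index_enum //= negb_imply Pi sign_mul_eq0 -mcoeff_msupp.
Qed.

(** After the sign correction, each coefficient of the product is a sum of nonnegative terms, so the
    support is the full Minkowski sum. *)
Lemma signedM d e f g : signed d f -> signed e g -> signed (d + e) (f * g) /\
  forall m, m \in msupp (f * g) <->
    exists a b, [/\ a \in msupp f, b \in msupp g & m = (a + b)%MM].
Proof.
move=> sf sg.
have E m : (-1) ^+ (d + e + mdeg m) * (f * g)@_m =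
  \sum_(k : 'X_{1..n < (mdeg m).+1, (mdeg m).+1} | m == (k.1 + k.2)%MM)
    ((-1) ^+ (d + mdeg k.1) * f@_k.1) * ((-1) ^+ (e + mdeg k.2) * g@_k.2).
  rewrite mcoeffM mulr_sumr; apply: eq_bigr => k /eqP {1}->.
  by rewrite mdegD !exprD; ring.
have P m (k : 'X_{1..n < (mdeg m).+1, (mdeg m).+1}) :
    0 <= ((-1) ^+ (d + mdeg k.1) * f@_k.1) * ((-1) ^+ (e + mdeg k.2) * g@_k.2).
  by apply: mulr_ge0; [apply: sf | apply: sg].
split=> m; first by rewrite E sumr_ge0.
rewrite mcoeff_msupp -(sign_mul_eq0 (d + e + mdeg m)) E psumr_eq0 // -has_predC.
split=> [/hasP[k _ /=]|[a [b [fa gb mE]]]].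
  rewrite negb_imply mulf_eq0 !sign_mul_eq0 negb_or -!mcoeff_msupp => /and3P[/eqP mk fk gk].
  by exists k.1, k.2.
have am : (mdeg a < (mdeg m).+1)%N by rewrite mE mdegD; lia.
have bm : (mdeg b < (mdeg m).+1)%N by rewrite mE mdegD; lia.
apply/hasP; exists (BMultinom am, BMultinom bm); rewrite ?mem_index_enum //=.
by rewrite negb_imply mulf_eq0 !sign_mul_eq0 negb_or -!mcoeff_msupp fa gb mE eqxx.
Qed.

Lemma mulm_addn m a b : (m *+ (a + b) = m *+ a + m *+ b)%MM.
Proof. by apply/mnmP => i; rewrite mnmDE !mulmnE mulnDr. Qed.

Lemma signedXn i k : signed k ('X_i ^+ k).
Proof.
move=> m; rewrite mpolyXn mcoeffX; case: eqP => [<-|_]; last by rewrite mulr0.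
by rewrite mdegMn mdeg1 mul1n mulr1 addnn -signr_odd odd_double.
Qed.

Lemma msuppXn i k m : (m \in msupp ('X_i ^+ k : {mpoly int[n]})) = (m == U_(i) *+ k)%MM.
Proof. by rewrite mpolyXn msuppX inE. Qed.

Lemma signed1BX i : signed 0 (1 - 'X_i).
Proof.
move=> m; rewrite mcoeffB mcoeff1 mcoeffX add0n; case: eqP => [->|m0].
  by rewrite mdeg0 mnm1_eq0.
by case: eqP => [<-|_]; rewrite ?mdeg1 ?subrr ?mulr0.
Qed.

Lemma msupp1BX i m : (m \in msupp (1 - 'X_i : {mpoly int[n]})) = (m == 0%MM) || (m == U_(i))%MM.
Proof.
rewrite mcoeff_msupp mcoeffB mcoeff1 mcoeffX; have [->|m0] := eqVneq m 0%MM.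
  by rewrite mnm1_eq0.
by rewrite [m == _]eq_sym; case: (_ == m).
Qed.

Lemma signed1BXn i c : signed 0 ((1 - 'X_i) ^+ c) /\
  forall m, m \in msupp ((1 - 'X_i : {mpoly int[n]}) ^+ c) <->
    exists2 t, (t <= c)%N & m = (U_(i) *+ t)%MM.
Proof.
elim: c => [|c [s IH]].
  rewrite expr0; split=> m.
    rewrite mcoeff1 add0n; case: eqP => [->|_]; by rewrite ?mdeg0 ?mulr0.
  rewrite mcoeff_msupp mcoeff1; have [->|m0] := eqVneq m 0%MM; split=> //.
    by exists 0%N; rewrite ?mulm0n.
  by case=> t; rewrite leqn0 => /eqP -> mE; case/eqP: m0; rewrite mE mulm0n.
rewrite exprS; have [s' H] := signedM (signed1BX i) s; split=> // m; rewrite H; split.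
  case=> a [b [/[!msupp1BX]/orP[]/eqP -> /IH[t tc ->] ->]].
    by exists t; rewrite ?add0m //; apply: leqW.
  by exists t.+1; rewrite // mulmS.
case=> -[|t] tc ->; [exists 0%MM, 0%MM | exists U_(i)%MM, (U_(i) *+ t)%MM].
  by rewrite msupp1BX eqxx mulm0n addm0; split=> //; apply/IH; exists 0%N.
by rewrite msupp1BX eqxx orbT mulmS; split=> //; apply/IH; exists t.
Qed.

End Signed.

Section Support.
Variables (n N : nat).
Implicit Types (la : nat -> nat) (m : 'X_{1..n}) (I J : {set 'I_n}) (z : 'I_n).

Lemma psum_strip k la (mu : {ffun 'I_k -> 'I_N}) :
  mu \in family (fun i : 'I_k => strip (N := N) la i) ->
  (strip_size la mu + psum (ext mu) k = psum la k.+1)%N.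
Proof.
move=> /familyP h; rewrite /strip_size psumS -addnA addnC; congr addn.
rewrite /psum -big_split /=; apply: eq_bigr => i _.
by have := h i; rewrite extE /in_mem /= /strip; lia.
Qed.

Lemma corners_strip k la (mu : {ffun 'I_k -> 'I_N}) :
  strip_corners la mu = psum (corners la (ext mu)) k.
Proof. by apply: eq_bigr => i _; rewrite /corners extE. Qed.

Lemma interlace_strip k la (mu : {ffun 'I_k -> 'I_N}) :
  mu \in family (fun i : 'I_k => strip (N := N) la i) <-> interlace k la (ext mu).
Proof.
split=> [/familyP h i ik|h]; first by have := h (Ordinal ik); rewrite -[i]/(val (Ordinal ik)) extE.
by apply/familyP => i; have := h i (ltn_ord i); rewrite extE.
Qed.

Lemma signed_sgroth k la : (k <= n)%N -> signed (psum la k) (sgroth n N k la).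
Proof.
elim: k la => [|k IH] la kn /=.
  by rewrite psum0 => m; rewrite mcoeff1; case: eqP => [->|_]; rewrite ?mdeg0 ?mulr0.
apply: signed_sum => mu hmu; rewrite -[k]/(val (Ordinal kn)) xnE /=.
rewrite -(psum_strip hmu) -[X in signed (X + _)]add0n.
apply: (signedM _ (IH _ (ltnW kn))).1.
exact: (signedM (signed1BXn _ _).1 (@signedXn _ _ _)).1.
Qed.

(** The branching rule read on supports: nothing cancels, and a corner factor [1 - x_k] raises the
    exponent t of the last variable by 0 or 1. *)
Lemma msupp_sgrothS k la (kn : (k < n)%N) m : m \in msupp (sgroth n N k.+1 la) <->
  exists mu : {ffun 'I_k -> 'I_N}, interlace k la (ext mu) /\
  exists t m', [/\ psum la k.+1 <= t + psum (ext mu) k <=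
                     psum la k.+1 + psum (corners la (ext mu)) k,
    m' \in msupp (sgroth n N k (ext mu)) & m = (U_(Ordinal kn) *+ t + m')%MM]%N.
Proof.
have S (mu : {ffun 'I_k -> 'I_N}) :=
  signedM (signed1BXn (Ordinal kn) (strip_corners la mu)).1 (@signedXn n (Ordinal kn) (strip_size la mu)).
have T (mu : {ffun 'I_k -> 'I_N}) := signedM (S mu).1 (signed_sgroth (ext mu) (ltnW kn)).
have xk : xn n k = 'X_(Ordinal kn) by rewrite -[k]/(val (Ordinal kn)) xnE.
rewrite /= xk; apply: (iff_trans (msupp_signed_sum (d := psum la k.+1) _ m)).
  by move=> mu hmu; rewrite -(psum_strip hmu) -[X in signed (X + _)]add0n; apply: (T mu).1.
split=> [[mu hmu]|[mu [hmu [t [m' [ht hm' ->]]]]]].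
  case/(T mu).2 => a [b [/(S mu).2[a1 [a2 [h1 h2 ->]]] hb ->]].
  case/(signed1BXn _ _).2: h1 => t1 ht ->; move: h2; rewrite msuppXn => /eqP ->.
  exists mu; split; first exact/interlace_strip.
  exists (t1 + strip_size la mu)%N, b; split=> //; last by rewrite mulm_addn.
  by rewrite -(psum_strip hmu) -corners_strip; lia.
have hmu' := (interlace_strip la mu).2 hmu.
exists mu => //; apply/(T mu).2; exists (U_(Ordinal kn) *+ t)%MM, m'; split=> //.
have sz := psum_strip hmu'; rewrite -corners_strip -sz in ht.
apply/(S mu).2; exists (U_(Ordinal kn) *+ (t - strip_size la mu))%MM, (U_(Ordinal kn) *+ strip_size la mu)%MM.
split; last by rewrite -mulm_addn subnK //; lia.
  by apply/(signed1BXn _ _).2; exists (t - strip_size la mu)%N => //; lia.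
by rewrite msuppXn.
Qed.

Definition msum m (I : {set 'I_n}) : nat := (\sum_(i in I) m i)%N.

(* The integer points of the generalized polymatroid, without truncated subtraction. *)
Definition in_gpoly k la m : Prop :=
  (forall i : 'I_n, (k <= i)%N -> m i = 0%N) /\
  forall I : {set 'I_n}, I \subset below n k ->
    (psum la k <= msum m I + psum la (k - #|I|))%N /\ (msum m I <= psum (hat la) #|I|)%N.

Lemma belowS k (kn : (k < n)%N) : below n k.+1 = Ordinal kn |: below n k.
Proof. by apply/setP => i; rewrite !inE ltnS leq_eqVlt. Qed.

Lemma card_below k : (k <= n)%N -> #|below n k| = k.
Proof.
elim: k => [|k IH] kn; first by apply: eq_card0 => i; rewrite inE.
by rewrite (belowS kn) cardsU1 IH ?(ltnW kn) // inE ltnn.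
Qed.

Lemma subset_below_card k (I : {set 'I_n}) : (k <= n)%N -> I \subset below n k -> (#|I| <= k)%N.
Proof. by move=> kn /subset_leq_card; rewrite card_below. Qed.

Lemma subset_belowS k (kn : (k < n)%N) (I : {set 'I_n}) : I \subset below n k.+1 ->
  I \subset below n k \/ exists J : {set 'I_n},
    [/\ J \subset below n k, #|I| = #|J|.+1, Ordinal kn \notin J & I = Ordinal kn |: J].
Proof.
rewrite (belowS kn) => sI; have [zI|zI] := boolP (Ordinal kn \in I); last first.
  left; apply/subsetP => i iI; have := subsetP sI i iI; rewrite in_setU1.
  by case/predU1P => // iz; rewrite -iz iI in zI.
right; exists (I :\ Ordinal kn); split; first by rewrite subDset.
- by rewrite (cardsD1 (Ordinal kn) I) zI.
- by rewrite !inE eqxx.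
- by rewrite setD1K.
Qed.

Lemma msumU1 m z J : z \notin J -> msum m (z |: J) = (m z + msum m J)%N.
Proof. by move=> zJ; rewrite /msum big_setU1. Qed.

Lemma msum_addU k (kn : (k < n)%N) t m J : Ordinal kn \notin J ->
  msum (U_(Ordinal kn) *+ t + m)%MM J = msum m J.
Proof.
move=> zJ; apply: eq_bigr => i iJ; rewrite mnmDE mulmnE mnm1E.
by case: eqP => [iz|]; [rewrite iz iJ in zJ | rewrite mul0n].
Qed.

Lemma below_notin k (kn : (k < n)%N) J : J \subset below n k -> Ordinal kn \notin J.
Proof. by move=> sJ; apply/negP => /(subsetP sJ); rewrite inE ltnn. Qed.

(** Induction on k. Sets without the last variable use [sum_interlace_low] and the monotonicity of
    [hat]; sets with it use the bounds on t, [mu <= la] and [sum_interlace_high]. *)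
Lemma msupp_sgroth_in_gpoly k la m : (k <= n)%N ->
  m \in msupp (sgroth n N k la) -> in_gpoly k la m.
Proof.
elim: k la m => [|k IH] la m kn.
  rewrite /= mcoeff_msupp mcoeff1; have [->|] := eqVneq m 0%MM => // _.
  split=> [i _|I sI]; first by rewrite mnm0E.
  have := subset_below_card kn sI; rewrite leqn0 cards_eq0 => /eqP ->.
  by rewrite /msum big_set0 cards0 !psum0.
case/(msupp_sgrothS _ kn) => mu [hmu [t [m' [/andP[t1 t2] /(IH _ _ (ltnW kn))[v1 v2] mE]]]].
have sub := sum_interlace_low hmu; have sup := sum_interlace_high hmu.
have hatm r : (r < k)%N -> (hat (ext mu) r <= hat la r)%N.
  by move=> rk; apply: leq_hat => s sr; have := hmu s; lia.
have mum j : (j <= k)%N -> (psum (ext mu) j <= psum la j)%N.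
  by move=> jk; apply: leq_psum => i ij; have := hmu i; lia.
split=> [i ki|I sI].
  rewrite mE mnmDE mulmnE mnm1E v1 ?addn0 1?ltnW //.
  by case: eqP => // iz; move: ki; rewrite -iz /= ltnn.
case: (subset_belowS kn sI) => [sJ|[J [sJ cJ zJ ->]]].
  have ck := subset_below_card (ltnW kn) sJ; have [w1 w2] := v2 I sJ.
  rewrite mE msum_addU ?below_notin //; split.
    have -> : (k.+1 - #|I| = (k - #|I|).+1)%N by lia.
    by have := sub (k - #|I|)%N; lia.
  by apply: leq_trans w2 (leq_psum _) => i ij; apply: hatm; lia.
have ck := subset_below_card (ltnW kn) sJ; have [w1 w2] := v2 J sJ.
have -> : msum m (Ordinal kn |: J) = (t + msum m' J)%N.
  by rewrite msumU1 // mE msum_addU // mnmDE mulmnE mnm1E eqxx mul1n v1 // addn0.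
rewrite cardsU1 zJ add1n subSS; split.
  by have := mum (k - #|J|)%N; lia.
by have := sup #|J|; lia.
Qed.

(** The exponent vector [m] is dominated by an intermediate shape [nu]. The last variable is peeled
    off by removing a strip of size [m z] from [nu], and [strip_choice] supplies the matching [mu]
    inside [la]. *)
Lemma in_msupp_sgroth k la nu m : (k <= n)%N -> (la 0 < N)%N ->
  (forall i, (i.+1 < k)%N -> (la i.+1 <= la i)%N) ->
  (forall i, (i.+1 < k)%N -> (nu i.+1 <= nu i)%N) ->
  (forall i, (i < k)%N -> (la i <= nu i <= hat la i)%N) ->
  (forall i : 'I_n, (k <= i)%N -> m i = 0%N) ->
  (forall I : {set 'I_n}, I \subset below n k -> (msum m I <= psum nu #|I|)%N) ->
  msum m (below n k) = psum nu k ->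
  m \in msupp (sgroth n N k la).
Proof.
elim: k la nu m => [|k IH] la nu m kn laN dla dnu lanu m0 dom tot.
  have -> : m = 0%MM by apply/mnmP => i; rewrite mnm0E m0.
  by rewrite /= mcoeff_msupp mcoeff1 eqxx.
pose z := Ordinal kn; pose m' : 'X_{1..n} := [multinom (if i == z then 0 else m i)%N | i < n].
have mm' : m = (U_(z) *+ m z + m')%MM.
  apply/mnmP => i; rewrite mnmDE mulmnE mnm1E mnmE eq_sym.
  by case: eqP => [->|_]; rewrite ?mul1n ?addn0.
have zK : z \notin below n k by rewrite inE ltnn.
have msum' J : J \subset below n k -> msum m' J = msum m J.
  by move=> sJ; rewrite mm' [in RHS]msum_addU ?below_notin // -mm'.
have totz : (m z + msum m (below n k) = psum nu k.+1)%N.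
  by rewrite -msumU1 // -belowS.
have sK J : J \subset below n k -> J \subset below n k.+1.
  by move=> sJ; apply: subset_trans sJ _; rewrite (belowS kn) subsetUr.
have domz J : J \subset below n k -> (m z + msum m J <= psum nu #|J|.+1)%N.
  move=> sJ; have zJ := below_notin kn sJ; rewrite -msumU1 //.
  have := dom (z |: J); rewrite cardsU1 zJ add1n; apply.
  by rewrite (belowS kn) setUS.
(* The bounds on [m z] come from domination on the set of the first k variables and on the singleton
   of [z]. *)
have [nu' [i1 i2 i3]] : exists nu', [/\ interlace k nu nu', (psum nu' k + m z)%N = psum nu k.+1 &
    forall j, (j <= k)%N -> psum nu' j = minn (psum nu j) (psum nu j.+1 - m z)].
  apply: remove_strip => //; apply/andP; split.
    have := dom (below n k) (sK _ (subxx _)).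
    by rewrite (card_below (ltnW kn)) => h; move: totz; rewrite psumS; lia.
  by have := domz set0 (sub0set _); rewrite cards0 /msum big_set0 psumS psum0; lia.
have [mu0 [j1 j2 j3 j4]] := strip_choice dla lanu i1 i2.
have mu0N i : (i < k)%N -> (mu0 i < N)%N.
  move=> ik; apply: leq_ltn_trans laN; apply: (@leq_trans (la i)); first by have := j1 i ik; lia.
  by apply: (descending_leq dla) => //; apply: ltnW.
pose mu : {ffun 'I_k -> 'I_N} := [ffun i : 'I_k => Ordinal (mu0N i (ltn_ord i))].
have muE i : (i < k)%N -> ext mu i = mu0 i.
  by move=> ik; rewrite -[i]/(val (Ordinal ik)) extE ffunE.
apply/(msupp_sgrothS _ kn); exists mu; split.
  by move=> i ik; rewrite muE //; apply: j1.
exists (m z), m'; split=> //.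
  rewrite (eq_psum muE) (@eq_psum (corners la (ext mu)) (corners la mu0)) // => i ik.
  by rewrite /corners muE.
apply: (IH _ nu') => //.
- exact: ltnW.
- case: (posnP k) => [k0|k0]; last by rewrite muE // mu0N.
  by rewrite /ext insubF //= ?k0 //; apply: leq_ltn_trans laN.
- by move=> i ik; rewrite !muE ?j2 // ltnW.
- by move=> i ik; have := i1 i (ltnW ik); have := i1 i.+1 ik; lia.
- move=> i ik; rewrite muE // (@eq_hat mu0) ?j3 // => s si.
  by rewrite muE //; apply: leq_ltn_trans ik.
- move=> i ki; rewrite mnmE; case: eqP => // iz; apply: m0.
  by rewrite ltn_neqAle ki andbT; apply/eqP => E; case: iz; apply/val_inj.
(* The two terms of the minimum are domination by [nu] on J and on J with [z] added. *)
- move=> J sJ; rewrite msum' // i3 ?(subset_below_card (ltnW kn)) //.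
  by have := dom J (sK _ sJ); have := domz J sJ; lia.
- by rewrite msum' //; lia.
Qed.

Lemma msupp_sgroth k la m : (k <= n)%N -> (la 0 < N)%N ->
  (forall i, (i.+1 < k)%N -> (la i.+1 <= la i)%N) ->
  m \in msupp (sgroth n N k la) <-> in_gpoly k la m.
Proof.
move=> kn laN dec; split; first exact: msupp_sgroth_in_gpoly.
case=> m0 bound; have [lo hi] := bound _ (subxx (below n k)).
rewrite card_below // subnn psum0 addn0 in lo hi.
have [|nu [n1 n2 n3]] := @dominating_shape k la (msum m (below n k) - psum la k) dec.
  by lia.
have K J : J \subset below n k -> (#|J| <= k)%N by apply: subset_below_card.
apply: (@in_msupp_sgroth k la nu) => // [J sJ|].
  rewrite n3 ?K // leq_min; apply/andP; split; first by case: (bound J sJ).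
  (* The lower bound on the complement of J turns into the upper bound [psum la #|J| + e] on J. *)
  have [lo' _] := bound (below n k :\: J) (subsetDl _ _).
  have E : (msum m J + msum m (below n k :\: J) = msum m (below n k))%N.
    rewrite /msum (bigID (mem J) (fun i => i \in below n k)) /=; congr addn.
      by apply: eq_bigl => i; case: (boolP (i \in J)) => [/(subsetP sJ) ->|]; rewrite ?andbF.
    by apply: eq_bigl => i; rewrite inE andbC.
  have : (#|below n k :\: J| = k - #|J|)%N by rewrite cardsDS // card_below.
  by move=> c; rewrite c in lo'; move: lo'; rewrite subKn ?K //; lia.
by rewrite n3 //; lia.
Qed.

End Support.

(** * Generalized polymatroids *)

Section BasePolytope.
Variables (R : realType) (T : finType) (b : {set T} -> int).
Implicit Types (x y : T -> R) (I J C : {set T}) (i j : T).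

Hypothesis b_sub : forall I J, b (I :|: J) + b (I :&: J) <= b I + b J.
Hypothesis b0 : b set0 = 0.

Definition ssum x I : R := \sum_(i in I) x i.

Definition in_base x : Prop :=
  (forall I, ssum x I <= (b I)%:~R) /\ ssum x setT = (b setT)%:~R.

Definition tight x I : bool := ssum x I == (b I)%:~R.

Lemma ssumUI x I J : ssum x (I :|: J) + ssum x (I :&: J) = ssum x I + ssum x J.
Proof.
rewrite /ssum ![\sum_(i in _) _]big_mkcond -!big_split /=; apply: eq_bigr => i _.
by rewrite !inE; case: (i \in I); case: (i \in J); rewrite /= ?addr0 ?add0r.
Qed.

(** Submodularity of [b] and modularity of [ssum x] squeeze both inequalities into equalities. *)
Lemma tightUI x I J : in_base x -> tight x I -> tight x J ->
  tight x (I :|: J) && tight x (I :&: J).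
Proof.
case=> xb _ /eqP tI /eqP tJ; have := ssumUI x I J; rewrite tI tJ /tight => E.
have := b_sub I J; rewrite -(ler_int R) !intrD -E => h.
have := xb (I :|: J); have := xb (I :&: J).
by move=> h1 h2; apply/andP; split; rewrite eq_le ?h1 ?h2 /=; lra.
Qed.

Lemma tightU x I J : in_base x -> tight x I -> tight x J -> tight x (I :|: J).
Proof. by move=> xb tI tJ; case/andP: (tightUI xb tI tJ). Qed.

Lemma tightI x I J : in_base x -> tight x I -> tight x J -> tight x (I :&: J).
Proof. by move=> xb tI tJ; case/andP: (tightUI xb tI tJ). Qed.

Lemma tight0 x : tight x set0.
Proof. by rewrite /tight /ssum big_set0 b0. Qed.

Definition slack_sets x : nat := #|[set C | ~~ tight x C]|.

Definition shift x i j (e : R) : T -> R :=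
  fun l => x l + e * ((l == i)%:R - (l == j)%:R).

Lemma ssum_shift x i j e C :
  ssum (shift x i j e) C = ssum x C + e * ((i \in C)%:R - (j \in C)%:R).
Proof.
have S l : \sum_(h in C) (h == l)%:R = (l \in C)%:R :> R.
  have [lC|lC] := boolP (l \in C).
    by rewrite (bigD1 l lC) /= eqxx big1 ?addr0 // => h /andP[_ /negPf ->].
  by rewrite big1 // => h hC; case: eqP => // hl; rewrite -hl hC in lC.
by rewrite /ssum big_split /= -mulr_sumr sumrB !S.
Qed.

(* Move along e_i - e_j until a new constraint becomes tight. *)
Lemma push_to_tight x i j : in_base x -> i != j ->
  (forall C, tight x C -> (i \in C) = (j \in C)) ->
  exists2 e, 0 < e & in_base (shift x i j e) /\
    (slack_sets (shift x i j e) < slack_sets x)%N.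
Proof.
move=> xb ij eqt; have [xle xT] := xb.
pose P C := (i \in C) && (j \notin C); pose slack C := (b C)%:~R - ssum x C.
have P1 : P [set i] by rewrite /P !inE eqxx eq_sym.
case: (arg_minP slack P1) => C0 PC0 minC0; pose e := slack C0.
have nt C : P C -> ~~ tight x C.
  by case/andP=> iC /negPf jC; apply/negP => /eqt; rewrite iC jC.
have e0 : 0 < e.
  by rewrite subr_gt0 lt_neqAle (xle C0) andbT; apply: nt.
have keep C : tight x C -> tight (shift x i j e) C.
  by move=> tC; rewrite /tight ssum_shift (eqt C tC) subrr mulr0 addr0; exact: tC.
exists e => //; split; first split=> [C|].
- rewrite ssum_shift; have [iC|iC] := boolP (i \in C); have [jC|jC] := boolP (j \in C).
  + by rewrite subrr mulr0 addr0.
  + have PC : P C by rewrite /P iC jC.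
    by have := minC0 C PC; rewrite -/e {1}/e /slack /= subr0 mulr1; rewrite -/(slack C0) -/e => h; rewrite -lerBrDl.
  + by rewrite sub0r mulrN1; apply: le_trans (xle C); rewrite gerBl ltW.
  + by rewrite subrr mulr0 addr0.
- by rewrite ssum_shift !inE subrr mulr0 addr0.
apply/proper_card/properP; split.
  by apply/subsetP => C; rewrite !inE; apply/contra/keep.
exists C0; rewrite !inE ?nt // negbK /tight ssum_shift.
by case/andP: PC0 => -> /negPf ->; rewrite subr0 mulr1 /e /slack addrC subrK.
Qed.

(** [A] is the least tight set containing i, and [B] the largest tight subset of [A] avoiding i. The
    sum of x over [A :\: B] is an integer, so i is not the only fractional index there, and no tight
    set separates two indices of [A :\: B] one of which is i. *)
Lemma fractional_pair x i : in_base x -> x i \isn't a Num.int ->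
  exists2 j, i != j & forall C, tight x C -> (i \in C) = (j \in C).
Proof.
move=> xb xi.
pose A := \bigcap_(C | tight x C && (i \in C)) C.
have tA : tight x A.
  rewrite /A; elim/big_ind: _ => [|I J|C /andP[]//]; last exact: tightI.
  by rewrite /tight; apply/eqP; case: xb.
have iA : i \in A by apply/bigcapP => C /andP[].
have sA C : tight x C -> i \in C -> A \subset C.
  by move=> tC iC; apply: bigcap_inf; rewrite tC.
pose B := \bigcup_(C | [&& tight x C, i \notin C & C \subset A]) C.
have tB : tight x B.
  rewrite /B; elim/big_ind: _ => [|I J|C /andP[]//]; [exact: tight0 | exact: tightU].
have iB : i \notin B by apply/negP => /bigcupP[C /and3P[_ /negP]].
have BA : B \subset A by apply/bigcupsP => C /and3P[].
have sumAB : ssum x (A :\: B) = (b A - b B)%:~R.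
  rewrite intrB -(eqP tA) -(eqP tB) /ssum [X in _ = X - _](big_setID B) /=.
  by rewrite (setIidPr BA) [RHS]addrC addKr.
have [/existsP[j /andP[/andP[jAB ji] _]]|/existsPn no] :=
    boolP [exists j, (j \in A :\: B) && (i != j) && (x j \isn't a Num.int)].
  exists j => // C tC; move: jAB; rewrite inE => /andP[jB jA].
  have [iC|iC] := boolP (i \in C); first by rewrite (subsetP (sA C tC iC)).
  (* A tight C containing j but not i would make [C :&: A] one of the sets whose union is [B]. *)
  apply/esym/negP => jC; case/negP: jB; apply/bigcupP; exists (C :&: A); last by rewrite inE jC.
  by rewrite tightI // inE (negPf iC) subsetIr.
case/negP: xi; have -> : x i = (b A - b B)%:~R - \sum_(j in (A :\: B) :\ i) x j.
  by rewrite -sumAB /ssum (big_setD1 i) /= ?inE ?iB // addrK.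
rewrite rpredB ?intr_int // rpred_sum // => j; rewrite in_setD1 => /andP[ji jAB].
by have := no j; rewrite jAB eq_sym ji /= negbK.
Qed.

(** Integrality stated as an induction principle. A fractional point is a convex combination of two
    points of the polytope, obtained by moving in opposite directions, each with fewer slack
    sets. *)
Lemma base_polytope_ind (Q : (T -> R) -> Prop) :
  (forall x y, x =1 y -> Q x -> Q y) ->
  (forall x y (a : R), 0 <= a -> a <= 1 -> Q x -> Q y ->
     Q (fun l => a * x l + (1 - a) * y l)) ->
  (forall t : T -> int, in_base (fun l => (t l)%:~R) -> Q (fun l => (t l)%:~R)) ->
  forall x, in_base x -> Q x.
Proof.
move=> Qext Qconv Qint x; have [m] := ubnP (slack_sets x).
elim: m x => // m IH x; rewrite ltnS => xm xb.
have [/existsP[i xi]|/existsPn no] := boolP [exists i, x i \isn't a Num.int]; last first.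
  have E : (fun l => (Num.floor (x l))%:~R) =1 x.
    by move=> l; apply: floorK; have := no l; rewrite negbK.
  apply: (Qext _ _ E); apply: Qint; have [xle xT] := xb.
  have S C : ssum (fun l => (Num.floor (x l))%:~R) C = ssum x C.
    by apply: eq_bigr => l _; apply: E.
  by split=> [C|]; rewrite S.
have [j ij eqt] := fractional_pair xb xi.
have [e e0 [eb em]] := push_to_tight xb ij eqt.
have ji : j != i by rewrite eq_sym.
have eqt' C : tight x C -> (j \in C) = (i \in C) by move=> /eqt ->.
have [f f0 [fb fm]] := push_to_tight xb ji eqt'.
have ef : e + f != 0 by rewrite gt_eqF // addr_gt0.
apply: (Qext (fun l => (f / (e + f)) * shift x i j e l + (1 - f / (e + f)) * shift x j i f l)).
  by move=> l; rewrite /shift; field.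
apply: Qconv; [| |apply: IH => //; lia|apply: IH => //; lia].
  by rewrite divr_ge0 ?addr_ge0 // ltW.
by rewrite ler_pdivrMr ?addr_gt0 // mul1r lerDr ltW.
Qed.

End BasePolytope.

Section GeneralizedPolymatroid.
Variables (R : realType) (n : nat) (y z : {set 'I_n} -> int).
Implicit Types (I J : {set 'I_n}) (C D : {set 'I_n.+1}) (t : 'I_n -> R).

Hypothesis y_super : forall I J, y I + y J <= y (I :|: J) + y (I :&: J).
Hypothesis z_sub : forall I J, z (I :|: J) + z (I :&: J) <= z I + z J.
Hypothesis yz_para : forall I J, z (I :\: J) - y (J :\: I) <= z I - y J.
Hypothesis y0 : y set0 = 0.
Hypothesis z0 : z set0 = 0.

(* A generalized polymatroid is the projection of a base polytope with one extra
   coordinate, placed at index 0, which makes the total equal to zero. *)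
Definition tailset C : {set 'I_n} := [set i | lift ord0 i \in C].

Definition homogenized C : int :=
  if ord0 \in C then - y (~: tailset C) else z (tailset C).

Definition homogenize (U : zmodType) (t : 'I_n -> U) (o : 'I_n.+1) : U :=
  if unlift ord0 o is Some i then t i else - \sum_i t i.

(** Two sets containing the extra index give supermodularity of [y] on complements, two sets without
    it give submodularity of [z], and the mixed cases are the paramodular inequality. *)
Lemma homogenized_sub C D :
  homogenized (C :|: D) + homogenized (C :&: D) <= homogenized C + homogenized D.
Proof.
have TU : tailset (C :|: D) = tailset C :|: tailset D by apply/setP => i; rewrite !inE.
have TI : tailset (C :&: D) = tailset C :&: tailset D by apply/setP => i; rewrite !inE.
rewrite /homogenized !inE TU TI; move: (tailset C) (tailset D) => c d.
case: (ord0 \in C); case: (ord0 \in D) => //=.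
- by rewrite setCU setCI; have := y_super (~: c) (~: d); lia.
- have := yz_para d (~: c).
  have -> : ~: c :\: d = ~: (c :|: d) by rewrite setCU setDE.
  by rewrite setDE setCK [d :&: c]setIC; lia.
- have := yz_para c (~: d).
  have -> : ~: d :\: c = ~: (c :|: d) by rewrite setCU setDE setIC.
  by rewrite setDE setCK; lia.
Qed.

Lemma homogenized0 : homogenized set0 = 0.
Proof. by rewrite /homogenized inE (_ : tailset set0 = set0) //; apply/setP => i; rewrite !inE. Qed.

Lemma ssum_homogenize t C : ssum (homogenize t) C =
  if ord0 \in C then - ssum t (~: tailset C) else ssum t (tailset C).
Proof.
rewrite /ssum big_mkcond big_ord_recl /homogenize unlift_none /=.
have -> : \sum_(i < n) (if lift ord0 i \in C then
    if unlift ord0 (lift ord0 i) is Some j then t j else - \sum_i t i else 0) =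
    \sum_(i in tailset C) t i.
  by rewrite [RHS]big_mkcond; apply: eq_bigr => i _; rewrite liftK inE.
case: (ord0 \in C); last by rewrite add0r.
rewrite (bigID (fun i => i \in tailset C)) /= opprD addrAC addNr add0r.
by congr (- _); apply: eq_bigl => i; rewrite in_setC.
Qed.

Definition in_gpolymatroid t : Prop :=
  forall I, (y I)%:~R <= ssum t I <= (z I)%:~R.

Lemma in_base_homogenize t : in_gpolymatroid t -> in_base homogenized (homogenize t).
Proof.
move=> h; split=> [C|].
  rewrite ssum_homogenize /homogenized; case: (ord0 \in C); last by case/andP: (h (tailset C)).
  by rewrite rmorphN /= lerN2; case/andP: (h (~: tailset C)).
rewrite ssum_homogenize /homogenized !inE.
have -> : ~: tailset setT = set0 by apply/setP => i; rewrite !inE.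
by rewrite y0 /ssum big_set0 oppr0.
Qed.

Lemma gpolymatroid_ind (Q : ('I_n -> R) -> Prop) :
  (forall t u, t =1 u -> Q t -> Q u) ->
  (forall t u (a : R), 0 <= a -> a <= 1 -> Q t -> Q u ->
     Q (fun i => a * t i + (1 - a) * u i)) ->
  (forall t : 'I_n -> int, in_gpolymatroid (fun i => (t i)%:~R) -> Q (fun i => (t i)%:~R)) ->
  forall t, in_gpolymatroid t -> Q t.
Proof.
move=> Qext Qconv Qint t /in_base_homogenize ht.
pose Q' (x : 'I_n.+1 -> R) := Q (fun i => x (lift ord0 i)).
apply: (Qext (fun i => homogenize t (lift ord0 i))) => [i|]; first by rewrite /homogenize liftK.
apply: (base_polytope_ind homogenized_sub homogenized0 (Q := Q') _ _ _ ht).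
- by move=> x x' E; apply: Qext => i; apply: E.
- by move=> x x' a a0 a1; apply: Qconv.
(* As the total is zero, the lower bound on I is the constraint on the complement of its image,
   which contains [ord0]. *)
move=> x [xle xT]; apply: Qint => I; apply/andP; split.
  have := xle (~: [set lift ord0 i | i in I]).
  have E : tailset (~: [set lift ord0 i | i in I]) = ~: I.
    by apply/setP => i; rewrite !inE mem_imset //; apply: lift_inj.
  have o : ord0 \in ~: [set lift ord0 i | i in I].
    by rewrite inE; apply/negP => /imsetP[i _ /eqP]; rewrite (negPf (neq_lift _ _)).
  rewrite /homogenized o E setCK rmorphN /=.
  have : ssum (fun l => (x l)%:~R : R) setT = 0.
    rewrite xT /homogenized inE; have -> : ~: tailset setT = set0 by apply/setP => i; rewrite !inE.
    by rewrite y0 oppr0.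
  rewrite /ssum (big_setID [set lift ord0 i | i in I]) /= setTI setTD big_imset /=.
    by move=> e1 e2; lra.
  by move=> i j _ _; apply: lift_inj.
have := xle [set lift ord0 i | i in I].
have E : tailset [set lift ord0 i | i in I] = I.
  by apply/setP => i; rewrite !inE mem_imset //; apply: lift_inj.
rewrite /homogenized ifN ?E.
  by rewrite /ssum big_imset //= => i j _ _; apply: lift_inj.
by apply/negP => /imsetP[i _ /eqP]; rewrite (negPf (neq_lift _ _)).
Qed.

End GeneralizedPolymatroid.

(** * The paramodular pair of bounds *)

Section RankFunctions.
Variables (n k : nat) (la : nat -> nat).
Implicit Types (I J : {set 'I_n}) (m : 'X_{1..n}).
Hypothesis kn : (k <= n)%N.
Hypothesis dec : forall i, (i.+1 < k)%N -> (la i.+1 <= la i)%N.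

Definition upper I : nat := psum (hat la) #|I :&: below n k|.
Definition lower I : nat := (psum la k - psum la (k - #|I :&: below n k|))%N.

(** A block of c terms of f starting at b is at most the block of g starting at a. The three choices
    of [la] and [hat la] for f and g yield supermodularity, submodularity and the mixed
    inequality. *)
Lemma psum_exchange (f g : nat -> nat) (a b c : nat) :
  (forall i j, (i <= j)%N -> (j < k)%N -> (f j <= g i)%N) -> (a <= b)%N -> (b + c <= k)%N ->
  (psum f (b + c) + psum g a <= psum f b + psum g (a + c))%N.
Proof.
move=> fg ab; elim: c => [|c IH] bc; first by rewrite !addn0.
rewrite !addnS !psumS; have := fg (a + c)%N (b + c)%N; rewrite addnS in bc.
by have := IH (ltnW bc); lia.
Qed.

Lemma psum_mono (f : nat -> nat) a b : (a <= b)%N -> (psum f a <= psum f b)%N.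
Proof.
move=> /subnKC <-; elim: (b - a)%N => [|d IH]; first by rewrite addn0.
by rewrite addnS psumS; lia.
Qed.

Lemma hat_desc i j : (i <= j)%N -> (hat la j <= hat la i)%N.
Proof. by move=> ij; apply: (@descending_leq j.+1) => // l _; apply: hat_dec. Qed.

Lemma la_desc i j : (i <= j)%N -> (j < k)%N -> (la j <= la i)%N.
Proof. exact: descending_leq. Qed.

Lemma la_hat i j : (i <= j)%N -> (j < k)%N -> (la j <= hat la i)%N.
Proof. by move=> ij jk; apply: leq_trans (hat_geq dec jk) (hat_desc ij). Qed.

Lemma card_below_leq I : (#|I :&: below n k| <= k)%N.
Proof. by apply: subset_below_card => //; apply: subsetIr. Qed.

Lemma card_below_UI I J :
  (#|(I :|: J) :&: below n k| + #|(I :&: J) :&: below n k| =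
   #|I :&: below n k| + #|J :&: below n k|)%N.
Proof. by rewrite setIUl setIIl cardsUI. Qed.

Lemma upper_sub I J : (upper (I :|: J) + upper (I :&: J) <= upper I + upper J)%N.
Proof.
have E := card_below_UI I J.
have vp : (#|(I :&: J) :&: below n k| <= #|I :&: below n k|)%N.
  by apply/subset_leq_card/setSI/subsetIl.
have uk := card_below_leq (I :|: J); rewrite /upper.
have := @psum_exchange (hat la) (hat la) _ _ (#|(I :|: J) :&: below n k| - #|I :&: below n k|)
  (fun i j ij _ => hat_desc ij) vp.
have -> : (#|(I :&: J) :&: below n k| + (#|(I :|: J) :&: below n k| - #|I :&: below n k|) =
  #|J :&: below n k|)%N.
  have : (#|I :&: below n k| <= #|(I :|: J) :&: below n k|)%N.
    by apply/subset_leq_card/setSI/subsetUl.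
  by lia.
rewrite subnKC; last by apply/subset_leq_card/setSI/subsetUl.
by move=> /(_ uk); lia.
Qed.

Lemma lower_super I J : (lower I + lower J <= lower (I :|: J) + lower (I :&: J))%N.
Proof.
have E := card_below_UI I J.
have vp : (#|(I :&: J) :&: below n k| <= #|I :&: below n k|)%N.
  by apply/subset_leq_card/setSI/subsetIl.
have pu : (#|I :&: below n k| <= #|(I :|: J) :&: below n k|)%N.
  by apply/subset_leq_card/setSI/subsetUl.
have uk := card_below_leq (I :|: J); rewrite /lower.
have L j := @psum_mono la (k - j) k (leq_subr _ _).
have := @psum_exchange la la (k - #|(I :|: J) :&: below n k|) (k - #|I :&: below n k|)
  (#|I :&: below n k| - #|(I :&: J) :&: below n k|) la_desc.
have -> : (k - #|I :&: below n k| + (#|I :&: below n k| - #|(I :&: J) :&: below n k|) =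
  k - #|(I :&: J) :&: below n k|)%N by lia.
have -> : (k - #|(I :|: J) :&: below n k| + (#|I :&: below n k| - #|(I :&: J) :&: below n k|) =
  k - #|J :&: below n k|)%N by lia.
have := L #|I :&: below n k|; have := L #|J :&: below n k|.
have := L #|(I :|: J) :&: below n k|; have := L #|(I :&: J) :&: below n k|.
by lia.
Qed.

Lemma card_belowD I J : (#|(I :\: J) :&: below n k| =
  #|I :&: below n k| - #|(I :&: J) :&: below n k|)%N.
Proof. by rewrite setIDAC cardsD setIAC. Qed.

Lemma upper_lower_para I J :
  (upper (I :\: J) + lower J <= upper I + lower (J :\: I))%N.
Proof.
have E := card_below_UI I J.
have vp : (#|(I :&: J) :&: below n k| <= #|I :&: below n k|)%N.
  by apply/subset_leq_card/setSI/subsetIl.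
have vq : (#|(I :&: J) :&: below n k| <= #|J :&: below n k|)%N.
  by apply/subset_leq_card/setSI/subsetIr.
have uk := card_below_leq (I :|: J); have qk := card_below_leq J.
rewrite /upper /lower !card_belowD [J :&: I]setIC.
have L j := @psum_mono la (k - j) k (leq_subr _ _).
have := @psum_exchange la (hat la) (#|I :&: below n k| - #|(I :&: J) :&: below n k|)
  (k - #|J :&: below n k|) #|(I :&: J) :&: below n k| la_hat.
have -> : (k - #|J :&: below n k| + #|(I :&: J) :&: below n k| =
  k - (#|J :&: below n k| - #|(I :&: J) :&: below n k|))%N by lia.
rewrite subnK //.
have := L #|J :&: below n k|; have := L (#|J :&: below n k| - #|(I :&: J) :&: below n k|)%N.
by lia.
Qed.

Lemma upper0 : upper set0 = 0%N.
Proof. by rewrite /upper set0I cards0 psum0. Qed.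

Lemma lower0 : lower set0 = 0%N.
Proof. by rewrite /lower set0I cards0 subn0 subnn. Qed.

(** For [k <= i] the bound [upper [set i]] is 0, so the inequalities over all sets already force the
    exponents outside the first k variables to vanish. *)
Lemma in_gpolyE m :
  in_gpoly k la m <-> forall I, (lower I <= msum m I <= upper I)%N.
Proof.
split=> [[m0 h] I|h].
  have -> : msum m I = msum m (I :&: below n k).
    rewrite /msum (big_setID (below n k)) /= [X in (_ + X)%N]big1 ?addn0 // => i.
    by rewrite !inE -leqNgt => /andP[/m0].
  by have [] := h _ (subsetIr I (below n k)); rewrite /lower /upper; lia.
split=> [i ki|I sI].
  have := h [set i]; rewrite /upper (_ : [set i] :&: below n k = set0).
    by rewrite cards0 psum0 /msum big_set1; lia.
  by apply/setP => j; rewrite !inE; case: eqP => // ->; rewrite ltnNge ki.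
have := h I; rewrite /lower /upper (setIidPl sI).
by have := @psum_mono la (k - #|I|) k (leq_subr _ _); lia.
Qed.

Lemma msumD1 m i I : msum (m + U_(i))%MM I = (msum m I + (i \in I))%N.
Proof.
rewrite /msum; have [iI|iI] := boolP (i \in I).
  rewrite !(big_setD1 i iI) /= mnmDE mnm1E eqxx -!addnA; congr addn.
  rewrite addnC; congr addn; apply: eq_bigr => j; rewrite !inE mnmDE mnm1E eq_sym.
  by case/andP => /negPf ->; rewrite addn0.
rewrite addn0; apply: eq_bigr => j jI; rewrite mnmDE mnm1E.
by case: eqP => [ij|]; [rewrite ij jI in iI | rewrite addn0].
Qed.

(* Sets with msum m I = upper I are closed under union, so some coordinate below k
   avoids all of them unless m has maximal degree. *)
Lemma in_gpoly_incr m : in_gpoly k la m -> (mdeg m < psum (hat la) k)%N ->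
  exists i, in_gpoly k la (m + U_(i))%MM.
Proof.
move=> /in_gpolyE h md; pose tight I := msum m I == upper I.
have tightU I J : tight I -> tight J -> tight (I :|: J).
  move=> /eqP tI /eqP tJ; rewrite /tight; have := upper_sub I J.
  have := h (I :|: J); have := h (I :&: J).
  suff : (msum m (I :|: J) + msum m (I :&: J) = msum m I + msum m J)%N by rewrite tI tJ; lia.
  rewrite /msum ![(\sum_(i in _) _)%N]big_mkcond -!big_split /=; apply: eq_bigr => i _.
  by rewrite !inE; case: (i \in I); case: (i \in J); rewrite /= ?addn0 ?add0n.
pose B := \bigcup_(I | tight I) I.
have /eqP tB : tight B.
  rewrite /B; elim/big_ind: _ => //.
  by rewrite /tight upper0 /msum big_set0.
have [sB|/subsetPn[i ik iB]] := boolP (below n k \subset B).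
  move: tB; rewrite /upper (setIidPr sB) card_below // => tB.
  have : (msum m B <= mdeg m)%N.
    by rewrite mdegE /msum [X in (_ <= X)%N](bigID (mem B)) /= leq_addr.
  by rewrite tB leqNgt md.
exists i; apply/in_gpolyE => I; rewrite msumD1; have := h I.
have [iI|iI] := boolP (i \in I); last by rewrite addn0.
have : ~~ tight I by apply: contra iB => tI; apply/bigcupP; exists I.
by rewrite /tight; lia.
Qed.

Lemma in_gpoly_mdeg m : in_gpoly k la m -> (mdeg m <= psum (hat la) k)%N.
Proof.
move/in_gpolyE/(_ setT)/andP => [_]; rewrite /upper setTI card_below // mdegE.
by rewrite /msum (eq_bigl xpredT) // => i; rewrite inE.
Qed.

End RankFunctions.

(** * Convex hulls and conclusion *)

Section Hull.
Variables (R : realType) (n : nat) (S : seq 'X_{1..n}).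
Implicit Types (t u : 'I_n -> R).

Lemma in_hull_ext t u : t =1 u -> in_hull S t -> in_hull S u.
Proof. by move=> E [lam [l0 l1 lt]]; exists lam; split=> // i; rewrite -E. Qed.

Lemma in_hull_convex t u (a : R) : 0 <= a -> a <= 1 -> in_hull S t -> in_hull S u ->
  in_hull S (fun i => a * t i + (1 - a) * u i).
Proof.
move=> a0 a1 [lam [l0 l1 lt]] [mu [m0 m1 mt]].
exists (fun m => a * lam m + (1 - a) * mu m); split=> [m mS||i].
- by rewrite addr_ge0 // mulr_ge0 ?subr_ge0 ?l0 ?m0.
- by rewrite big_split /= -!mulr_sumr l1 m1 !mulr1 subrKC.
- rewrite lt mt !mulr_sumr -big_split; apply: eq_bigr => m _.
  by rewrite /=; ring.
Qed.

Lemma in_hull_vertex m : uniq S -> m \in S -> in_hull S (fun i => (m i)%:R : R).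
Proof.
move=> uS mS; exists (fun m' => (m' == m)%:R); split=> [m' _||i].
- exact: ler0n.
- by rewrite (bigD1_seq m) //= eqxx big1 ?addr0 // => m' /negPf ->.
- by rewrite (bigD1_seq m) //= eqxx mul1r big1 ?addr0 // => m' /negPf ->; rewrite mul0r.
Qed.

Lemma in_hull_sum_bounds t (I : {set 'I_n}) (lo hi : nat) : in_hull S t ->
  (forall m, m \in S -> lo <= msum m I <= hi)%N -> lo%:R <= \sum_(i in I) t i <= hi%:R.
Proof.
case=> lam [l0 l1 lt] h.
have -> : \sum_(i in I) t i = \sum_(m <- S) lam m * (msum m I)%:R.
  rewrite (eq_bigr (fun i => \sum_(m <- S) lam m * (m i)%:R)) // exchange_big /=.
  by apply: eq_bigr => m _; rewrite natr_sum mulr_sumr.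
have E c : c = \sum_(m <- S) lam m * c by rewrite -mulr_suml l1 mul1r.
rewrite [lo%:R]E [hi%:R]E !big_seq; apply/andP; split; apply: ler_sum => m mS.
  by rewrite ler_wpM2l ?l0 // ler_nat; case/andP: (h m mS).
by rewrite ler_wpM2l ?l0 // ler_nat; case/andP: (h m mS).
Qed.

End Hull.

Lemma grassmannian_split n (w : 'S_n) : grassmannian w -> exists k, [/\ (k <= n)%N,
  forall i : nat, (i.+1 < k)%N -> (wn w i < wn w i.+1)%N &
  forall i : nat, (k <= i)%N -> (i.+1 < n)%N -> (wn w i < wn w i.+1)%N].
Proof.
move=> /cards1P[j0 E].
have asc (i : nat) : (i.+1 < n)%N -> i != j0 -> (wn w i < wn w i.+1)%N.
  move=> iN ij; pose o := Ordinal (ltnW iN); have so : succ_ord o = i.+1 :> nat by apply: val_succ_ord.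
  have : o \notin [set j | descent w j] by rewrite E inE -val_eqE.
  rewrite inE /descent iN /= -leqNgt leq_eqVlt => /predU1P[/val_inj/perm_inj oE|].
    by move/(congr1 val): oE; rewrite /= so; lia.
  by rewrite -!wnE so.
(* Positions are numbered from 0, so [j0.+1] positions precede the drop. *)
exists j0.+1; split; first exact: ltn_ord.
  by move=> i ij; apply: asc; [apply: leq_trans ij (ltn_ord j0) | lia].
by move=> i ij iN; apply: asc => //; lia.
Qed.

Theorem theorem3p19 (R : realType) (n : nat) (w : 'S_n) :
  grassmannian w ->
  (@SNP n R (groth w) /\ @newton_gen_polymatroid n R (groth w)) /\
  (forall a : 'X_{1..n}, a \in msupp (groth w) ->
     (mdeg a < tdeg (groth w))%N ->
     exists2 b : 'X_{1..n}, b \in msupp (groth w) &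
       mlt a b /\ mdeg b = (mdeg a).+1).
Proof.
move=> /grassmannian_split[k [kn asc1 asc2]].
have [N [la [dec laN ->]]] := groth_sgroth kn asc1 asc2.
set f := sgroth n N k la.
have supp m : m \in msupp f <-> in_gpoly k la m by apply: msupp_sgroth.
pose y (I : {set 'I_n}) : int := (lower k la I)%:Z; pose z (I : {set 'I_n}) : int := (upper k la I)%:Z.
have hull_bounds (t : 'I_n -> R) : in_hull (msupp f) t -> in_gpolymatroid y z t.
  move=> ht I; apply: (in_hull_sum_bounds ht) => m /supp/(in_gpolyE _ kn); exact.
have int_point (t : 'I_n -> int) : in_gpolymatroid y z (fun i => (t i)%:~R : R) ->
    exists2 m, m \in msupp f & forall i, t i = (m i)%:Z.
  move=> ht; have tS I : (y I <= \sum_(i in I) t i <= z I)%R.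
    by have := ht I; rewrite /ssum -(rmorph_sum (intr : int -> R)) /= !ler_int.
  (* The lower bounds are natural numbers, hence the coordinates are nonnegative. *)
  have t0 i : t i = `|t i|%N%:Z.
    by have := tS [set i]; rewrite big_set1 /y; lia.
  pose m : 'X_{1..n} := [multinom `|t i|%N | i < n].
  have tm i : t i = (m i)%:Z by rewrite mnmE.
  exists m => //; apply/supp/(in_gpolyE _ kn) => I; have := tS I.
  rewrite (eq_bigr (fun i => Posz (m i))) => [|i _]; last exact: tm.
  by rewrite -(big_morph Posz PoszD (erefl _)).
split; first split.
- move=> a; split=> [/hull_bounds|[m mf am]]; first exact: int_point.
  apply: in_hull_ext (in_hull_vertex _ (msupp_uniq _) mf) => i.
  by rewrite am.
- have ys I J : y I + y J <= y (I :|: J) + y (I :&: J).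
    by have := lower_super kn dec I J; rewrite /y; lia.
  have zs I J : z (I :|: J) + z (I :&: J) <= z I + z J.
    by have := upper_sub la kn I J; rewrite /z; lia.
  have yz I J : z (I :\: J) - y (J :\: I) <= z I - y J.
    by have := upper_lower_para kn dec I J; rewrite /y /z; lia.
  exists (fun I => (y I)%:~R), (fun I => (z I)%:~R); split.
    by split=> I J; rewrite -!(intrD, intrB) ler_int.
  move=> t; split=> [/hull_bounds //|ht].
  apply: (gpolymatroid_ind ys zs yz _ _ _ _ _ ht).
  + by rewrite /y lower0.
  + by rewrite /z upper0.
  + exact: in_hull_ext.
  + exact: in_hull_convex.
  move=> u /int_point[m mf um]; apply: in_hull_ext (in_hull_vertex _ (msupp_uniq _) mf) => i.
  by rewrite um.
move=> a /supp af ad; have [|i bf] := in_gpoly_incr kn af.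
  (* The degree of [f] is at most [psum (hat la) k], so [a] lies strictly below the top degree. *)
  apply: leq_trans ad _; apply/bigmax_leqP_seq => m /supp mf _; exact: (in_gpoly_mdeg kn).
exists (a + U_(i))%MM; first exact/supp.
split; last by rewrite mdegD mdeg1 addn1.
split=> [j|/(congr1 mdeg)]; first by rewrite mnmDE leq_addr.
by rewrite mdegD mdeg1; lia.
Qed.
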